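(* Let $k\ge1$. For all $\epsilon_0,\delta>0$ there exist $n_k(\epsilon_0,\delta)$ and $\omega(\epsilon_0,\delta)$, with $\omega(\epsilon_0,\delta)\to0$ as $\delta\to0$ for each fixed $\epsilon_0$, such that the following holds. If a finite nonempty set $A\subset\mathbb{Z}^k$ lies in some $B=B(n_1,\ldots,n_k;v_1,\ldots,v_k;b)$ with $v_1,\ldots,v_k$ linearly independent and $n_1,\ldots,n_k\ge n_k(\epsilon_0,\delta)$, such that $|A|\ge\epsilon_0|B|$ and $d_k(A)\le\delta|A|$, then $$|\widehat{\operatorname{co}}(A)\setminus A|\le\omega(\epsilon_0,\delta)|A|.$$
   Context: For finite $A\subset\mathbb{Z}^k$, $d_k(A):=|A+A|-2^k|A|$. $B(n_1,\ldots,n_k;v_1,\ldots,v_k;b)=\{b+\sum_{i=1}^k\ell_iv_i:0\le\ell_i<n_i\}$. $\widehat{\operatorname{co}}(A)=\widetilde{\operatorname{co}}(A)\cap\Lambda_A$, where $\widetilde{\operatorname{co}}(A)$ is the real convex hull and $\Lambda_A=\langle A-a\rangle+a$ ($a\in A$) the affine sublattice spanned by $A$. *)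

(* Defs.v *)
From HB Require Import structures.
From mathcomp Require Import all_boot all_order all_algebra finmap.
From mathcomp Require Import all_classical all_reals all_analysis.

Set Implicit Arguments.
Unset Strict Implicit.
Unset Printing Implicit Defensive.

Import Order.TTheory GRing.Theory Num.Theory.
Import numFieldNormedType.Exports.

Local Open Scope classical_set_scope.
Local Open Scope ring_scope.

Definition sumset (k : nat) (A B : {fset 'rV[int]_k}) : {fset 'rV[int]_k} :=
  [fset (a + b)%R | a in A, b in B]%fset.

(* Integer-valued, since it may be negative. *)
Definition doubling_excess (k : nat) (A : {fset 'rV[int]_k}) : int :=
  (#|` sumset A A|)%:Z - (2 ^ k * #|` A|)%N%:Z.

Definition gap (k : nat) (n : 'I_k -> nat) (v : 'I_k -> 'rV[int]_k)
    (b : 'rV[int]_k) : {fset 'rV[int]_k} :=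
  let T := {dffun forall i : 'I_k, 'I_(n i)} in
  [fset (b + \sum_(i < k) v i *+ (l : T) i)%R | l in {: T}]%fset.

Definition embed (R : realType) (k : nat) (x : 'rV[int]_k) : 'rV[R]_k :=
  map_mx intr x.

Definition lin_indep (R : realType) (k : nat) (v : 'I_k -> 'rV[int]_k) : bool :=
  free [seq embed R (v i) | i <- enum 'I_k].

Definition convex_hull (R : realType) (k : nat) (S : set 'rV[R]_k) :
    set 'rV[R]_k :=
  smallest (@convex_set R 'rV[R]_k) S.

(* The coset a + <A - a>; it does not depend on the choice of a in A. *)
Definition affine_lattice (k : nat) (A : {fset 'rV[int]_k}) :
    set 'rV[int]_k :=
  [set x | exists2 a, a \in A &
     inIntSpan (in_tuple [seq y - a | y <- enum_fset A]) (x - a)].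

Definition discrete_hull (R : realType) (k : nat) (A : {fset 'rV[int]_k}) :
    set 'rV[int]_k :=
  (@embed R k @^-1` convex_hull (@embed R k @` [set` A])) `&` affine_lattice A.

Lemma finite_discrete_hull (R : realType) (k : nat) (A : {fset 'rV[int]_k}) :
  finite_set (discrete_hull R A).
Proof.
pose N : nat := (\sum_(a <- enum_fset A) \sum_(j < k) `|a ord0 j|)%N.
have leN a j : a \in A -> (`|a ord0 j| <= N)%N.
  move=> aA; rewrite /N (big_rem a)//= (bigD1 j)//= -addnA.
  exact: leq_addr.
pose f (l : {ffun 'I_k -> 'I_(N + N).+1}) : 'rV[int]_k :=
  \row_j ((l j)%:Z - N%:Z).
apply: (@sub_finite_set _ _ (f @` setT)); last exact: finite_image.
move=> x [hx _].
have {hx} xN : [set y : 'rV[R]_k | forall j, `|y ord0 j| <= N%:R] (embed R x).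
  apply: hx; split=> [y z t|_ [a aA <-] j]; last first.
    by rewrite mxE -intr_norm -abszE -pmulrn ler_nat leN.
  rewrite !inE => yN zN j.
  rewrite !mxE (le_trans (ler_normD _ _))// !normrM.
  have t0 : 0 <= t%:num by [].
  have t1 : 0 <= 1 - t%:num by rewrite subr_ge0.
  rewrite (ger0_norm t0) (ger0_norm t1).
  rewrite (le_trans (lerD (ler_wpM2l t0 (yN j)) (ler_wpM2l t1 (zN j))))//.
  by rewrite -mulrDl addrC subrK mul1r.
have {}xN j : `|x ord0 j| <= N%:Z.
  by have := xN j; rewrite mxE -intr_norm pmulrn ler_int.
exists [ffun j => inord (absz (x ord0 j + N%:Z))] => //.
apply/rowP => j; rewrite mxE ffunE.
have /andP[x1 x2] : - N%:Z <= x ord0 j <= N%:Z by rewrite -ler_norml.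
rewrite inordK; first by rewrite gez0_abs ?addrK// addrC -lerBlDl sub0r.
rewrite ltnS -lez_nat gez0_abs ?PoszD ?lerD2r//.
by rewrite addrC -lerBlDl sub0r.
Qed.

(* Main.v *)
Require Import Defs.
From HB Require Import structures.
From mathcomp Require Import all_boot all_order all_algebra finmap.
From mathcomp Require Import all_classical all_reals all_analysis.
From mathcomp Require Import zify ring lra.

(** Identify the progression with a box [0, n) and let G = A + A.  Counting pairs
    of sums in a sliding window, at a scale chosen by pigeonhole so that few
    points are near A at the larger scale but not at the smaller one, gives for
    every box Q at a bounded scale the local inequality
      |G cap 2Q| <= 2^k |A cap Q| + tau (unit volume).
    As a + A is contained in G, this compares the density of A in a box with that
    in its image under the homothety of centre a and ratio 1/2.  Iterating it
    from the whole box downwards shows that A has positive density close to each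
    of its points, hence, by approximating midpoints, that every point of the
    convex hull is close to A; then the centre may be any point of the hull, and
    the density of A is almost constant in the interior of the hull.
    Consequently, if a and a' in A are close, then a + A and a' + A nearly agree
    in G, so a' - a is an almost-period of A in every interior box.  These
    almost-periods form a lattice containing A - A, and counting pairs
    shows that A misses few points of the corresponding coset in the hull. *)

Set Implicit Arguments.
Unset Strict Implicit.
Unset Printing Implicit Defensive.

Import Order.TTheory GRing.Theory Num.Theory.

Local Open Scope ring_scope.

(** * Counting points in boxes *)

Section Counting.
Implicit Types T : eqType.

(** The local inequality is obtained from the complement: the windows produce about 2^k points of
    [G] outside [2Q] for each point of [A] outside [Q], and the global bound on the size of [G],
    used only there, turns this into an upper bound inside. Lengths are then measured in cells [m],
    about 2^J to a side. The obstacle is that density must be compared in boxes of [P] cells, a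
    fixed fraction of 2^J, while points of the hull are approximated only up to [D] cells and the
    error is paid [J + 1] times. Hence [J * D] must be much smaller than 2^J; the nearest-point
    argument gives [D] of order 2^(2J/3), and taking [J] large wins. The error [tau] of the local
    inequality must be small against 1/J, so the doubling constant and the least side length are
    chosen last. Almost-periods can be added without accumulating errors: each sum is witnessed
    again by an exact pair of points of [A], but only while it stays short. Short multiples of the
    axis vectors by [D0!] are almost-periods, so residues modulo [D0!] turn this partial group into
    a lattice. *)

Lemma count_inj T1 T2 (f : T1 -> T2) (s : seq T1) (t : seq T2) (P : pred T1)
    (Q : pred T2) :
  uniq s -> {in s &, forall x y, P x -> P y -> f x = f y -> x = y} ->
  {in s, forall x, P x -> (f x \in t) && Q (f x)} ->
  (count P s <= count Q t)%N.
Proof.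
move=> us inj_f sub; rewrite -!size_filter -(size_map f).
apply: uniq_leq_size => [|_ /mapP[x + ->]].
  rewrite map_inj_in_uniq ?filter_uniq// => x y.
  rewrite !mem_filter => /andP[Px xs] /andP[Py ys]; exact: inj_f.
by rewrite !mem_filter => /andP[Px xs]; have /andP[-> ->] := sub x xs Px.
Qed.

Lemma count_imp T (s : seq T) (P Q : pred T) :
  {in s, forall x, P x -> Q x} -> (count P s <= count Q s)%N.
Proof.
elim: s => //= x s IH sub; rewrite leq_add//; last first.
  by apply: IH => y ys; apply: sub; rewrite inE ys orbT.
case: (boolP (P x)) => // Px; rewrite sub ?inE ?eqxx//.
Qed.

Lemma count_or T (s : seq T) (P Q1 Q2 : pred T) :
  {in s, forall x, P x -> Q1 x || Q2 x} ->
  (count P s <= count Q1 s + count Q2 s)%N.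
Proof.
move=> sub; rewrite -count_predUI (leq_trans _ (leq_addr _ _))//.
exact: count_imp.
Qed.

Lemma count_ex T (I : finType) (s : seq T) (P : pred T) (Q : I -> pred T) :
  {in s, forall x, P x -> exists i, Q i x} ->
  (count P s <= \sum_i count (Q i) s)%N.
Proof.
elim: s => [|x s IH] sub /=; first by [].
rewrite big_split/= leq_add//; last first.
  by apply: IH => y ys; apply: sub; rewrite inE ys orbT.
case: (boolP (P x)) => // Px.
have [i Qi] := sub _ (mem_head _ _) Px.
by rewrite (bigD1 i)//= Qi.
Qed.

Lemma sumn_count_exchange T1 T2 (s : seq T1) (t : seq T2) (P : T1 -> T2 -> bool) :
  (\sum_(x <- s) count (P x) t = \sum_(y <- t) count (P^~ y) s)%N.
Proof.
under eq_bigr do rewrite -sum1_count big_mkcond.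
under [RHS]eq_bigr do rewrite -sum1_count big_mkcond.
exact: exchange_big.
Qed.

End Counting.

Section LatticeBox.
Variable k : nat.
Implicit Types (y : 'rV[int]_k) (L : 'I_k -> nat).

Definition zbox y L : seq 'rV[int]_k :=
  [seq y + \row_i (f i : nat)%:Z | f : {dffun forall i : 'I_k, 'I_(L i)}].

Lemma mem_zboxP y L (x : 'rV[int]_k) :
  reflect (forall i, y 0 i <= x 0 i < y 0 i + (L i)%:Z) (x \in zbox y L).
Proof.
apply: (iffP mapP) => [[f _ ->] i|yx].
  by rewrite !mxE lerDl ltrD2l ltz_nat ltn_ord lez_nat.
have lt_i i : (absz (x 0 i - y 0 i)%R < L i)%N.
  by have := yx i; move: (x 0 i) (y 0 i) => a b; lia.
exists (finfun (fun i => Ordinal (lt_i i))); first by rewrite mem_enum.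
apply/rowP => i; rewrite !mxE ffunE /=.
by have := yx i; move: (x 0 i) (y 0 i) => a b; lia.
Qed.

Lemma zbox_uniq y L : uniq (zbox y L).
Proof.
rewrite map_inj_uniq ?enum_uniq// => f g /addrI /rowP fg.
by apply/ffunP => i; apply/val_inj; have := fg i; rewrite !mxE => -[].
Qed.

Lemma size_zbox y L : size (zbox y L) = (\prod_i L i)%N.
Proof.
rewrite size_map -cardE card_dep_ffun foldrE big_map big_enum/=.
by apply: eq_bigr => i _; rewrite card_ord.
Qed.

(* The points leaving the box leave it through one of its faces. *)
Lemma count_box_shift_nat y L (u : 'rV[int]_k) :
  (count (fun x => (x + u)%R \notin zbox y L) (zbox y L) <=
   \sum_i absz (u 0%R i) * \prod_(j | j != i) L j)%N.
Proof.
pose Q i (x : 'rV[int]_k) := ~~ (y 0 i <= x 0 i + u 0 i < y 0 i + (L i)%:Z).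
have H1 : {in zbox y L, forall x, x + u \notin zbox y L -> exists i, Q i x}.
  move=> x _ xu; apply/existsP.
  rewrite -[[exists _, _]]negbK negb_exists; apply/negP => /forallP xQ.
  move/negP: xu; apply; apply/mem_zboxP => i.
  by rewrite !mxE; have := xQ i; rewrite /Q negbK.
apply: (leq_trans (count_ex H1)); apply: leq_sum => i _.
pose y' := y + (if 0 <= u 0 i then (Posz (L i - `|u 0 i|)) else 0) *: delta_mx 0 i.
pose L' j := if j == i then absz (u 0%R i) else L j.
have -> : (absz (u 0%R i) * \prod_(j | j != i) L j = \prod_j L' j)%N.
  rewrite [RHS](bigD1 i)//= /L' eqxx; congr (_ * _)%N.
  by apply: eq_bigr => j /negbTE ->.
rewrite -(size_zbox y') -(count_predT (zbox y' L')).
apply: (@count_inj _ _ id) => //; first exact: zbox_uniq.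
move=> x /mem_zboxP xB xQ; rewrite andbT; apply/mem_zboxP => j.
rewrite !mxE /L' eqxx/=; have [->|_] := eqVneq j i; last first.
  by rewrite mulr0 addr0; apply: xB.
rewrite mulr1; move: xQ (xB i); rewrite /Q.
move: (x 0 i) (y 0 i) (u 0 i) (L i) => a b c l.
by case: ifP => u0; lia.
Qed.

Lemma count_box_shift (R : realFieldType) y L (u : 'rV[int]_k) (t : R) :
  (forall i, (absz (u 0%R i))%:R <= t * (L i)%:R) ->
  (count (fun x => (x + u)%R \notin zbox y L) (zbox y L))%:R <=
    k%:R * t * (\prod_i L i)%:R.
Proof.
move=> ut; apply: (@le_trans _ _
  (\sum_i absz (u 0%R i) * \prod_(j | j != i) L j)%:R).
  by rewrite ler_nat count_box_shift_nat.
rewrite natr_sum.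
have -> : k%:R * t * (\prod_i L i)%:R = \sum_(i < k) t * (\prod_i L i)%:R.
  by rewrite sumr_const card_ord mulr_natl mulrnAl.
apply: ler_sum => i _; rewrite [in leRHS](bigD1 i)//= !natrM mulrA.
by rewrite ler_wpM2r.
Qed.

(* A point [x] of a convex set whose shift by [u] leaves the set can be pushed
   along [u] up to the last point inside the box; this is injective. *)
Lemma count_convex_shift_nat y L (u : 'rV[int]_k) (s : seq 'rV[int]_k)
    (C : pred 'rV[int]_k) :
  uniq s -> {subset s <= zbox y L} -> {in s, forall x, C x} ->
  {subset C <= zbox y L} ->
  (forall x t, C x -> C (x + u *+ t.+1) -> C (x + u)) ->
  (count (fun x => ~~ C (x + u)%R) s <=
   count (fun x => (x + u)%R \notin zbox y L) (zbox y L))%N.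
Proof.
move=> us sB sC CB convC.
pose B := zbox y L.
have [->|u0] := eqVneq u 0.
  have /eq_in_count -> : {in s, (fun x => ~~ C (x + 0)) =1 pred0}.
    by move=> x xs; rewrite addr0 sC.
  by rewrite count_pred0.
have injt x : injective (fun t => x + u *+ t).
  move=> t1 t2 /addrI/rowP e; apply/eqP.
  have [i ui] : exists i, u 0 i != 0.
    apply/existsP; rewrite -[[exists _, _]]negbK negb_exists.
    apply: contra u0 => /forallP ui; apply/eqP/rowP => i.
    by rewrite !mxE; apply/eqP; have := ui i; rewrite negbK.
  have := e i; rewrite !mulmxnE => /eqP.
  by rewrite -[_ *+ t1]mulr_natr -[_ *+ t2]mulr_natr (inj_eq (mulfI ui)) eqr_nat.
have bnd x t : x + u *+ t \in B -> exists2 t', (t <= t')%N &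
    (x + u *+ t' \in B) && (x + u *+ t'.+1 \notin B).
  move=> xt.
  have [n tn nB] : exists2 n, (t <= n)%N & x + u *+ n \notin B.
    have : ~~ all (fun n => x + u *+ n \in B) (iota t (size B).+1).
      apply/negP => /allP a.
      have : (size [seq (x + u *+ n)%R | n <- iota t (size B).+1] <= size B)%N.
        apply: uniq_leq_size; first by rewrite map_inj_uniq ?iota_uniq.
        by move=> _ /mapP[n nt ->]; exact: a.
      by rewrite size_map size_iota ltnn.
    by case/allPn => n; rewrite mem_iota => /andP[tn _]; exists n.
  have ex : exists n, (t <= n)%N && (x + u *+ n \notin B) by exists n; apply/andP.
  have [m /andP[tm mB] mmin] : exists2 m, (t <= m)%N && (x + u *+ m \notin B) &
      forall n', (t <= n')%N && (x + u *+ n' \notin B) -> (m <= n')%N.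
    by exists (ex_minn ex); case: ex_minnP.
  case: m tm mB mmin => [|m] tm mB mmin.
    by move: mB xt; rewrite leqn0 in tm; rewrite (eqP tm) => /negbTE ->.
  have ltm : (t <= m)%N.
    rewrite -ltnS ltn_neqAle tm andbT; apply: contra mB => /eqP <-//.
  exists m => //; rewrite mB andbT; apply/negPn/negP => nm.
  by have := mmin m; rewrite ltm nm ltnn; move/(_ isT).
have bndx x : exists t, (x \in B) ==> (x + u *+ t \in B) && (x + u *+ t.+1 \notin B).
  have [xB|nxB] := boolP (x \in B); last by exists 0%N.
  by have [|t' _ H] := bnd x 0%N; [rewrite addr0|exists t'; rewrite H].
pose T x := xchoose (bndx x).
have TP x : x \in B -> (x + u *+ T x \in B) && (x + u *+ (T x).+1 \notin B).
  exact/implyP/(xchooseP (bndx x)).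
apply: (@count_inj _ _ (fun x => x + u *+ T x)) => // [x x' xs x's nx nx' e|x xs nx].
  have wl x1 x2 : C x1 -> C x2 -> ~~ C (x2 + u) ->
      x1 + u *+ T x1 = x2 + u *+ T x2 -> (T x2 <= T x1)%N.
    move=> C1 C2 n2 e12; rewrite leqNgt; apply: contra n2 => lt12.
    apply: (convC x2 (T x2 - T x1).-1) => //.
    rewrite prednK ?subn_gt0// mulrnBr; last exact: ltnW.
    by rewrite addrA -e12 addrK.
  have eT : T x = T x'.
    apply/eqP; rewrite eqn_leq.
    apply/andP; split; first exact: (wl x' x (sC _ x's) (sC _ xs) nx (esym e)).
    exact: (wl x x' (sC _ xs) (sC _ x's) nx' e).
  by move: e; rewrite eT => /addIr.
have /andP[-> ] := TP x (sB _ xs).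
by rewrite mulrSr addrA => ->.
Qed.

End LatticeBox.

(** * Counting lattice points in real boxes with integral sides *)

Section RealBox.
Variables (R : archiRealFieldType) (k : nat).
Implicit Types (x : 'rV[R]_k) (L m : 'I_k -> nat) (s : seq 'rV[int]_k).
Implicit Types (a : 'rV[int]_k).

Definition inbox x L a : bool :=
  [forall i, x 0 i <= (a 0 i)%:~R < x 0 i + (L i)%:R].

Lemma inboxP x L a :
  reflect (forall i, x 0 i <= (a 0 i)%:~R < x 0 i + (L i)%:R) (inbox x L a).
Proof. exact: forallP. Qed.

(* A half-open real box with integral side lengths contains exactly as many
   lattice points as an integral box, wherever its corner is. *)
Lemma inbox_zbox x L a :
  inbox x L a = (a \in zbox (\row_i Num.ceil (x 0 i)) L).
Proof.
have E i : (x 0 i <= (a 0 i)%:~R < x 0 i + (L i)%:R) =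
    (Num.ceil (x 0 i) <= a 0 i < Num.ceil (x 0 i) + (L i)%:Z).
  rewrite ceil_le_int; congr andb.
  by rewrite -ltrBlDr -[RHS]ltrBlDr ltNge [RHS]ltNge ceil_le_int intrB.
by apply/inboxP/mem_zboxP => H i; have := H i; rewrite !mxE E.
Qed.

Lemma count_inbox_le s x L : uniq s -> (count (inbox x L) s <= \prod_i L i)%N.
Proof.
move=> us; rewrite -(size_zbox (\row_i Num.ceil (x 0 i))) -size_filter.
apply: uniq_leq_size; rewrite ?filter_uniq// => a.
by rewrite mem_filter inbox_zbox => /andP[].
Qed.

(** Both boxes contain exactly as many lattice points as their volume, so the shell between them
    holds exactly the difference, and the part of [s] in the shell is no larger. *)
Lemma count_inbox_shell s x L x' L' : uniq s ->
  (forall a, inbox x L a -> inbox x' L' a) ->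
  (count (inbox x' L') s + \prod_i L i <= count (inbox x L) s + \prod_i L' i)%N.
Proof.
move=> us sub; pose z' := zbox (\row_i Num.ceil (x' 0 i)) L'.
rewrite -(size_zbox (\row_i Num.ceil (x' 0 i)) L') -/z'.
have Lz : (\prod_i L i <= count (inbox x L) z')%N.
  rewrite -(size_zbox (\row_i Num.ceil (x 0 i))) -size_filter.
  apply: uniq_leq_size; rewrite ?zbox_uniq// => a az.
  by rewrite mem_filter inbox_zbox az -inbox_zbox sub// inbox_zbox.
have sz : (count (inbox x' L') s <= count (inbox x L) s +
    count (predI (inbox x' L') (predC (inbox x L))) s)%N.
  by apply: count_or => a _ /= ->; case: inbox.
have : (count (predI (inbox x' L') (predC (inbox x L))) s <=
    count (predC (inbox x L)) z')%N.
  apply: (@count_inj _ _ id) => // a _ /andP[].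
  by rewrite inbox_zbox => -> /= ->.
by have := count_predC (inbox x L) z'; lia.
Qed.

Definition dil (P : nat) m : 'I_k -> nat := fun i => (P * m i)%N.

Lemma prod_dil P m : (\prod_i dil P m i = P ^ k * \prod_i m i)%N.
Proof. by rewrite big_split/= prod_nat_const card_ord. Qed.

(** Both boxes lie in the second one enlarged by [d] cells on every side; the added term is the
    volume of that shell. *)
Lemma count_inbox_lip s x x' m (P d : nat) : uniq s ->
  (forall i, `|x 0 i - x' 0 i| <= (d * m i)%:R) ->
  (count (inbox x (dil P m)) s)%:R <= (count (inbox x' (dil P m)) s)%:R
    + ((P + 2 * d)%:R ^+ k - P%:R ^+ k) * (\prod_i m i)%:R :> R.
Proof.
move=> us xx'; pose x2 := x' - \row_i (d * m i)%:R.
have sub (z : 'rV[R]_k) : (forall i, `|z 0 i - x' 0 i| <= (d * m i)%:R) -> forall a,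
    inbox z (dil P m) a -> inbox x2 (dil (P + 2 * d) m) a.
  move=> zx' a /inboxP za; apply/inboxP => i; have := za i; have := zx' i.
  rewrite !mxE /dil ler_norml mulnDl mul2n -addnn mulnDl !natrD.
  move: (z 0 i) (x' 0 i) (a 0 i)%:~R (d * m i)%:R (P * m i)%:R => b c e f g.
  by move=> /andP[? ?] /andP[? ?]; apply/andP; split; lra.
have H : (count (inbox x (dil P m)) s <=
    count (inbox x2 (dil (P + 2 * d) m)) s)%N.
  by apply: count_imp => a _; exact: sub.
have /(count_inbox_shell us) : forall a, inbox x' (dil P m) a ->
    inbox x2 (dil (P + 2 * d) m) a.
  by apply: sub => i; rewrite subrr normr0.
rewrite !prod_dil => H2.
have : (count (inbox x (dil P m)) s + P ^ k * \prod_i m i <=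
  count (inbox x' (dil P m)) s + (P + 2 * d) ^ k * \prod_i m i)%N by lia.
rewrite -(ler_nat R) natrD natrM natrX [in leRHS]natrD [in leRHS]natrM natrX.
by rewrite mulrBl; move: (_ * _) (_ * _) => u v; lra.
Qed.

(** The 2^k half-size boxes are disjoint: a point lies in the upper or lower half for each
    coordinate, and this determines [e]. *)
Lemma count_subboxes s x m P :
  (\sum_(e : {ffun 'I_k -> bool})
     count (inbox (x + \row_i (e i * (P * m i))%:R)%R (dil P m)) s <=
   count (inbox x (dil (2 * P) m)) s)%N.
Proof.
elim: s => /= [|a s IH]; first by rewrite big1.
rewrite big_split/= leq_add//.
have sub (e : {ffun 'I_k -> bool}) : inbox (x + \row_i (e i * (P * m i))%:R)%R (dil P m) a ->
    forall i, x 0%R i <= (a 0%R i)%:~R < x 0%R i + (2 * P * m i)%:R /\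
      e i = (x 0%R i + (P * m i)%:R <= (a 0%R i)%:~R).
  move=> /inboxP ea i; have := ea i; rewrite !mxE /dil.
  have : 0 <= (P * m i)%:R :> R by [].
  rewrite -mulnA [in (2 * _)%N]mul2n -addnn natrD.
  case: (e i) => /=; rewrite ?mul1n ?mul0n ?addr0;
    move: (x 0%R i) (a 0%R i)%:~R (P * m i)%:R => b c p p0 /andP[H1 H2];
    (split; first by apply/andP; split; lra).
    by have -> : b + p <= c by lra.
  by apply/esym/negbTE; rewrite -ltNge; lra.
have [/forallP noe|] := boolP [forall e : {ffun 'I_k -> bool},
    ~~ inbox (x + \row_i (e i * (P * m i))%:R)%R (dil P m) a].
  by rewrite big1// => e _; rewrite (negbTE (noe e)).
rewrite negb_forall => /existsP[e0]; rewrite negbK => e0a.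
have /inboxP -> : forall i, x 0%R i <= (a 0%R i)%:~R < x 0%R i + (dil (2 * P) m i)%:R.
  by move=> i; have [] := sub e0 e0a i.
rewrite (bigD1 e0)//= e0a big1// => e ee0; apply/eqP; rewrite eqb0.
apply: contra ee0 => ea; apply/eqP/ffunP => i.
by have [_ ->] := sub e ea i; have [_ ->] := sub e0 e0a i.
Qed.

End RealBox.

(** * A local homothety inequality for sumsets *)

Section SumsetCore.
Variables (R : archiRealFieldType) (k : nat).

Definition near_box (A : seq 'rV[int]_k) (d : 'I_k -> nat) (y : 'rV[int]_k) : bool :=
  has (fun a : 'rV[int]_k => [forall i, `|y 0%R i - a 0%R i| <= d i]%N) A.

Lemma near_boxP (A : seq 'rV[int]_k) (d : 'I_k -> nat) (y : 'rV[int]_k) :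
  reflect (exists2 a : 'rV[int]_k, a \in A & forall i, (`|y 0%R i - a 0%R i| <= d i)%N) (near_box A d y).
Proof.
by apply: (iffP hasP) => -[a aA /forallP ya]; exists a => //; apply/forallP.
Qed.

(** If some [a] in [A] is within [rad] of [x], then translating by [a] sends the points of [A] in
    the window at [x] into [G] and, up to [D] losses, into the window at [2x + e] for each [e] in
    {0,1}^k. The points [2x + e] are pairwise distinct, which yields the factor 2^k. Both sides are
    then sums over windows, each point being seen at most once per position in the window. *)
Lemma sumset_count (A G : seq 'rV[int]_k) (rad Lw L : 'I_k -> nat)
    (BB : seq 'rV[int]_k) (nu D : nat) (x0 : 'rV[R]_k) :
  uniq A -> uniq G -> {in A &, forall a b : 'rV[int]_k, a + b \in G} -> uniq BB ->
  (forall u : 'rV[int]_k, (forall i, (`|u 0%R i| <= rad i + 1)%N) ->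
     (count (fun w => (w + u)%R \notin zbox 0 Lw) (zbox 0 Lw) <= D)%N) ->
  (count (fun y => near_box A Lw y && ~~ near_box A rad y) BB <= nu)%N ->
  {in A & zbox 0 Lw, forall a w : 'rV[int]_k, a - w \in BB} ->
  (2 ^ k * (\prod_i Lw i * count (predC (inbox (x0 - \row_i (Lw i + 1)%:R)%R
       (fun i => L i + 2 * Lw i + 1))) A) <=
   \prod_i Lw i * count (predC (inbox (x0 + x0)%R (fun i => 2 * L i))) G +
   2 ^ k * (\prod_i Lw i * nu + size BB * D))%N.
Proof.
move=> uA uG AG uBB hD hnu hBB.
pose W := zbox 0 Lw.
have szW : size W = (\prod_i Lw i)%N by rewrite size_zbox.
rewrite -szW.
(* A window based at [2x + e] that meets the doubled box has [x] in the box negated here; centres in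
   [Y] therefore see only points of [G] outside the doubled box. *)
pose Y := predC (inbox (x0 - \row_i (Lw i + 1)%:R) (fun i => L i + Lw i + 1)%N).
pose X := [seq x <- BB | near_box A rad x && Y x].
have uX : uniq X by rewrite filter_uniq.
pose ev (e : {ffun 'I_k -> bool}) : 'rV[int]_k := \row_i (e i : nat)%:Z.
pose S := (\sum_(x <- X) count (fun b => (b - x)%R \in W) A)%N.
have H1 (x : 'rV[int]_k) (e : {ffun 'I_k -> bool}) : x \in X -> (count (fun b => (b - x)%R \in W) A <=
    count (fun g => (g - (x + x + ev e))%R \in W) G + D)%N.
  rewrite mem_filter => /andP[/andP[/near_boxP[a aA xa] _] _].
  pose u := a - x - ev e.
  have ub (b : 'rV[int]_k) : a + b - (x + x + ev e) = b - x + u.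
    by rewrite /u; apply/rowP => i; rewrite !mxE; ring.
  apply: (leq_trans (@count_or _ _ _
    (fun b => (a + b - (x + x + ev e))%R \in W)
    (fun b => ((b - x)%R \in W) && ((b - x + u)%R \notin W)) _)).
    by move=> b _ -> /=; rewrite ub orbN.
  apply: leq_add.
    apply: (@count_inj _ _ (fun b => a + b)) => // [b b' _ _ _ _ /addrI//|b bA ->].
    by rewrite AG.
  apply: leq_trans (hD u _); last first.
    move=> i; rewrite /u !mxE; have := xa i.
    by move: (x 0 i) (a 0 i) (e i) => b c [] /=; lia.
  apply: (@count_inj _ _ (fun b => b - x)) => // b b' _ _ _ _ /addIr->//.
pose XE := [seq (x, e) | x <- X, e <- enum {ffun 'I_k -> bool}].
have uXE : uniq XE.
  by apply: allpairs_uniq; rewrite ?enum_uniq// => -[? ?] [? ?] _ _ /=.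
pose hit (p : 'rV[int]_k * {ffun 'I_k -> bool}) (g : 'rV[int]_k) :=
  (g - (p.1 + p.1 + ev p.2)) \in W.
have ev_inj : forall (x : 'rV[int]_k) e (x' : 'rV[int]_k) e',
    x + x + ev e = x' + x' + ev e' -> (x, e) = (x', e').
  move=> x e x' e' /rowP H; congr (_, _).
    apply/rowP => i; have := H i; rewrite !mxE.
    by move: (x 0 i) (x' 0 i) (e i) (e' i) => c d [] [] /=; lia.
  apply/ffunP => i; have := H i; rewrite !mxE.
  by move: (x 0 i) (x' 0 i) (e i) (e' i) => c d [] [] //=; lia.
have H2 : (\sum_(p <- XE) count (hit p) G <=
    size W * count (predC (inbox (x0 + x0)%R (fun i => 2 * L i)%N)) G)%N.
  rewrite sumn_count_exchange -sum1_count big_distrr/= [leqRHS]big_mkcond/=.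
  apply: leq_sum => g _; case: ifPn => gin.
    rewrite muln1 -(count_predT W).
    apply: (@count_inj _ _ (fun p => g - (p.1 + p.1 + ev p.2))) => //.
      by move=> [x e] [x' e'] _ _ _ _ /= /addrI/oppr_inj/ev_inj.
    by move=> p _; rewrite /hit => ->.
  rewrite leqn0; apply/eqP; rewrite -size_filter; apply/eqP.
  rewrite size_eq0 -[_ == _]negbK -has_filter; apply/negP => /hasP[[x e]].
  move=> /allpairsP[[x' e'] /= [xX _ [-> ->]]]; rewrite /hit/= => /mem_zboxP gW.
  move: xX; rewrite mem_filter => /andP[/andP[_ /negP nY] _]; apply: nY; apply/inboxP.
  rewrite negbK in gin; move/inboxP: gin => gin i.
  have := gin i; have := gW i; rewrite !mxE.
  move: (x' 0 i) (x0 0 i) (g 0 i) (e' i) (Lw i) (L i) => z y h e1 l1 l2.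
  rewrite -(ler_int R) -(ltr_int R) !intrD !intrN !intrD.
  have : 0 <= l1%:R :> R by [].
  rewrite -[l1%:Z%:~R]/(l1%:R) natrM !natrD.
  have [-> | ->] : ((e1 : nat)%:Z%:~R = 1 :> R) \/ ((e1 : nat)%:Z%:~R = 0 :> R).
    by case: e1; [left|right].
  - move=> l0 /andP[? ?] /andP[? ?]; apply/andP; split; lra.
  - move=> l0 /andP[? ?] /andP[? ?]; apply/andP; split; lra.
have H3 : (size W * count (predC (inbox (x0 - \row_i (Lw i + 1)%:R)%R
       (fun i => L i + 2 * Lw i + 1)%N)) A <= S + size W * nu)%N.
  (* The point [b - w] is always within [Lw] of [b], so for fixed [w] the centres that are not
     within [rad] of [A] are among those counted by [nu]. *)
  have H4 : (\sum_(b <- A) count (fun w => ~~ near_box A rad (b - w)%R) W <=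
      size W * nu)%N.
    rewrite sumn_count_exchange -sum1_size big_distrl/= big_seq [leqRHS]big_seq.
    apply: leq_sum => w wW; rewrite mul1n; apply: leq_trans hnu.
    apply: (@count_inj _ _ (fun b => b - w)) => // [b b' _ _ _ _ /addIr//|b bA nb].
    rewrite hBB// nb andbT; apply/near_boxP; exists b => // i.
    move/mem_zboxP: wW => /(_ i); rewrite !mxE.
    by move: (b 0 i) (w 0 i) (Lw i) => c d l; lia.
  apply: leq_trans (leq_add (leqnn S) H4).
  rewrite /S sumn_count_exchange -big_split/= -sum1_count big_distrr/=.
  rewrite [leqLHS]big_mkcond/= big_seq [leqRHS]big_seq.
  apply: leq_sum => b bA; case: ifPn => // nbig.
  rewrite muln1 -(count_predC (fun w => near_box A rad (b - w))) leq_add//.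
  apply: (@count_inj _ _ (fun w => b - w)); first exact: zbox_uniq.
    by move=> ? ? _ _ _ _ /addrI/oppr_inj.
  move=> w wW nw; rewrite mem_filter nw/= hBB// andbT.
  rewrite subKr wW andbT.
  apply: contra nbig => /inboxP bw; apply/inboxP => i.
  have := bw i; move/mem_zboxP: wW => /(_ i); rewrite !mxE.
  move: (b 0 i) (x0 0 i) (w 0 i) (Lw i) (L i) => c y w' l1 l2.
  rewrite -(ler_int R) -(ltr_int R) !intrD !intrN mul2n -addnn !natrD.
  rewrite -[l1%:Z%:~R]/(l1%:R).
  by move=> /andP[? ?] /andP[? ?]; apply/andP; split; lra.
have H5 : (2 ^ k * S <= \sum_(p <- XE) count (hit p) G + 2 ^ k * (size BB * D))%N.
  have szE : size (enum {ffun 'I_k -> bool}) = (2 ^ k)%N.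
    by rewrite -cardE card_ffun card_bool card_ord.
  have szX : (size X <= size BB)%N by rewrite size_filter count_size.
  apply: (@leq_trans (\sum_(p <- XE) (count (hit p) G + D))%N).
    have -> : (2 ^ k * S = \sum_(p <- XE) count (fun b => (b - p.1)%R \in W) A)%N.
      rewrite /XE big_allpairs_dep/= /S big_distrr/=; apply: eq_bigr => x _.
      by rewrite big_const_seq iter_addn_0 count_predT szE mulnC.
    rewrite big_seq [leqRHS]big_seq.
    by apply: leq_sum => _ /allpairsP[[x e] /= [xX _ ->]]; exact: H1.
  rewrite big_split/= leq_add2l big_const_seq iter_addn_0 count_predT size_allpairs.
  by rewrite szE mulnC (mulnC (size X)) -mulnA leq_mul// leq_mul.
rewrite mulnDr (leq_trans _ (_ : (2 ^ k * (S + size W * nu) <= _)%N)) ?leq_mul//.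
by rewrite !mulnDr; lia.
Qed.
End SumsetCore.

Lemma exprD_sub_le (R : realDomainType) (a z b : R) (k : nat) :
  0 <= a -> 0 <= z -> a + z <= b -> 1 <= b ->
  (a + z) ^+ k - a ^+ k <= k%:R * z * b ^+ k.
Proof.
move=> a0 z0 ab b1; have b0 : 0 <= b by lra.
elim: k => [|k IH]; first by rewrite !expr0 subrr !mul0r.
have -> : (a + z) ^+ k.+1 - a ^+ k.+1 =
    (a + z) * ((a + z) ^+ k - a ^+ k) + z * a ^+ k by rewrite !exprS; ring.
have -> : k.+1%:R * z * b ^+ k.+1 = b * (k%:R * z * b ^+ k) + z * b ^+ k.+1.
  by rewrite exprS -natr1; ring.
apply: lerD.
  apply: ler_pM => //; first exact: addr_ge0.
  by rewrite subr_ge0 lerXn2r ?nnegrE ?addr_ge0// lerDl.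
rewrite ler_wpM2l// exprS; apply: (@le_trans _ _ (b ^+ k)).
  by rewrite lerXn2r ?nnegrE//; lra.
by rewrite ler_peMl ?exprn_ge0.
Qed.

(** If every increment exceeded [B / J], telescoping would push [u J] beyond [B]. Where [u]
    decreases, the truncated difference is 0 and the bound is immediate. *)
Lemma pigeonhole_increment (u : nat -> nat) (J B : nat) : (0 < J)%N ->
  (u J <= B)%N -> exists2 j, (j < J)%N & (J * (u j.+1 - u j) <= B)%N.
Proof.
move=> J0 uJ.
have [/existsP[[j jJ] /= H]|] := boolP [exists j : 'I_J, (J * (u j.+1 - u j) <= B)%N].
  by exists j.
rewrite negb_exists => /forallP H.
have {}H j : (j < J)%N -> (B < J * (u j.+1 - u j))%N.
  by move=> jJ; have := H (Ordinal jJ); rewrite -ltnNge.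
have : forall N, (N <= J)%N -> (N * B.+1 <= J * u N)%N.
  elim=> [//|N IH] NJ; have := H _ NJ; have := IH (ltnW NJ).
  have [uu|uu] := leqP (u N) (u N.+1).
    by rewrite mulnBr; have := leq_mul (leqnn J) uu; lia.
  by rewrite (eqP (ltnW uu : u N.+1 - u N == 0)%N) muln0.
by move/(_ J (leqnn J)); rewrite leq_pmul2l//; lia.
Qed.

(** * Choice of the window scales *)

Section Homothety.
Variables (R : archiRealFieldType) (k : nat).

Lemma nat_above (r : R) : exists2 N : nat, (0 < N)%N & r <= N%:R.
Proof.
exists (Num.bound `|r|).+1 => //; rewrite -natr1.
by have := archi_boundP (normr_ge0 r); have := ler_norm r; lra.
Qed.

Lemma eq_inbox (x : 'rV[R]_k) L L' : L =1 L' -> inbox x L =1 inbox x L'.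
Proof. by move=> e a; apply: eq_forallb => i; rewrite e. Qed.

Lemma prod_le_scale (n m : 'I_k -> nat) M : (0 < M)%N ->
  (forall i, m i = n i %/ M)%N -> (forall i, 0 < m i)%N ->
  (\prod_i n i <= (2 * M) ^ k * \prod_i m i)%N.
Proof.
move=> M0 mE m0; rewrite -prod_dil; apply: leq_prod => i _.
have := m0 i; rewrite /dil mE => mi.
have := ltn_ceil (n i) M0; nia.
Qed.

(** Subtracting the lower bound for [G] outside the doubled box from the bound on its total size
    leaves four errors of at most a quarter of [tau] cell volumes each: points between the two
    scales, window shifts, the excess [d0], and the enlargement of the box. *)
Lemma doubling_homothety (tau : R) (M : nat) : 0 < tau -> (0 < M)%N ->
  exists2 d0 : R, 0 < d0 & exists n0 : nat,
  forall (n : 'I_k -> nat) (A G : seq 'rV[int]_k),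
  (forall i, n0 <= n i)%N -> uniq A -> uniq G ->
  {in A &, forall a b : 'rV[int]_k, a + b \in G} ->
  {subset A <= zbox 0 n} ->
  (size G)%:R <= 2 ^+ k * (size A)%:R + d0 * (size A)%:R ->
  forall (x : 'rV[R]_k) (P : nat), (P <= 2 * M)%N ->
  (count (inbox (x + x) (dil (2 * P) (fun i => n i %/ M)%N)) G)%:R <=
  2 ^+ k * (count (inbox x (dil P (fun i => n i %/ M)%N)) A)%:R +
  tau * (\prod_i (n i %/ M))%:R.
Proof.
move=> tau0 M0.
(* The ambient box [BB] runs from [- n] to [2 n], of side [3 n], and [n] is at most [2 * M]
   cells. *)
pose C : R := (6 * M)%:R ^+ k.
have C0 : 0 < C by rewrite exprn_gt0// ltr0n; lia.
pose K : R := 2 ^+ k.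
have K0 : 0 < K by rewrite exprn_gt0.
(* [J] controls the pigeonholed increment, [q] the effect of a shift at the smaller scale on a
   window of the larger one, and [E'] the enlargement of the box. The product [E] lets windows at
   every scale, enlarged [3 * E'] times, fit in a cell. *)
have [J J0 JP] := nat_above (4 * K * C / tau).
have [q q0 qP] := nat_above (8 * K * C * k%:R / tau).
have [E' E'0 E'P] := nat_above (4 * K * (k%:R * (2 * M + 1)%:R ^+ k) / tau).
pose E := (3 * q ^ J * E')%N.
have E0 : (0 < E)%N by rewrite !muln_gt0 expn_gt0 q0 E'0.
exists (tau / (4 * C)); first by rewrite divr_gt0// mulr_gt0.
exists (M * E)%N => n A G hn uA uG AG AB hG x P PM.
pose m i := (n i %/ M)%N; pose h i := (m i %/ E)%N.
rewrite -/m; pose mu := (\prod_i m i)%N; rewrite -/mu.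
have mE i : (E <= m i)%N by rewrite /m leq_divRL// mulnC.
have m0 i : (0 < m i)%N by apply: leq_trans (mE i).
have h0 i : (0 < h i)%N by rewrite /h divn_gt0.
have nle : (\prod_i n i <= (2 * M) ^ k * mu)%N by exact: prod_le_scale.
pose BB := zbox (- \row_i (n i)%:Z) (fun i => 3 * n i)%N.
have szBB : (size BB)%:R <= C * mu%:R :> R.
  rewrite /C -natrX -natrM ler_nat size_zbox big_split/= prod_nat_const card_ord.
  by rewrite (_ : 6 = 3 * 2)%N// -mulnA (expnMn 3) -mulnA leq_mul.
have szA : (size A)%:R <= C * mu%:R :> R.
  apply: (le_trans _ szBB); rewrite ler_nat; apply: uniq_leq_size => // a /AB.
  move=> /mem_zboxP aB; apply/mem_zboxP => i; have := aB i; rewrite !mxE.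
  by move: (a 0 i) (n i) => b c; clear; lia.
have mn i : (m i <= n i)%N by rewrite /m leq_div.
(* Two consecutive scales with few points in between will serve as [rad] and [Lw]. *)
pose U j := count (near_box A (fun i => q ^ j * h i)%N) BB.
have [j jJ Uj] : exists2 j, (j < J)%N & (J * (U j.+1 - U j) <= size BB)%N.
  by apply: pigeonhole_increment => //; apply: count_size.
pose rad i := (q ^ j * h i)%N; pose Lw i := (q ^ j.+1 * h i)%N.
have rad0 i : (0 < rad i)%N by rewrite muln_gt0 expn_gt0 q0 h0.
have LwE i : (Lw i = q * rad i)%N by rewrite /Lw expnS mulnA.
have Lw0 i : (0 < Lw i)%N by rewrite LwE muln_gt0 q0 rad0.
have Lwm i : (3 * E' * Lw i <= m i)%N.
  apply: (@leq_trans (E * h i)%N); last by rewrite mulnC leq_divM.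
  have : (q ^ j.+1 <= q ^ J)%N by rewrite leq_pexp2l.
  rewrite /Lw /E; move: (q ^ j.+1)%N (q ^ J)%N (h i) => a b c; clear => ab.
  by have := leq_mul (leqnn (3 * E' * c)) ab; clear; lia.
pose W := zbox (0 : 'rV[int]_k) Lw.
have szW : size W = (\prod_i Lw i)%N by rewrite size_zbox.
(* A shift by at most [rad + 1], hence by at most [2 * rad], is a fraction [2 / q] of the side of
   the window. *)
pose D := Num.truncn (k%:R * (2 / q%:R) * (size W)%:R : R).
have hD (u : 'rV[int]_k) : (forall i, `|u 0%R i| <= rad i + 1)%N ->
    (count (fun w => (w + u)%R \notin W) W <= D)%N.
  move=> hu; rewrite /D truncn_ge_nat// szW; apply: count_box_shift => i.
  rewrite LwE natrM mulrA divfK ?pnatr_eq0 -?lt0n// -natrM ler_nat.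
  by have := hu i; have := rad0 i; move: (rad i) (u 0 i) => a b; clear; lia.
pose nu := (U j.+1 - U j)%N.
have hnu : (count (fun y => near_box A Lw y && ~~ near_box A rad y) BB <= nu)%N.
  have sub : {in BB, forall y, near_box A rad y -> near_box A Lw y}.
    move=> y _ /near_boxP[a aA ya]; apply/near_boxP; exists a => // i.
    by rewrite (leq_trans (ya i))// LwE leq_pmull.
  rewrite /nu leq_subRL; last by apply: count_imp.
  rewrite /U -/rad -/Lw -count_predUI.
  rewrite [X in (_ + X)%N](@eq_count _ _ pred0) ?count_pred0 ?addn0; last first.
    by move=> y /=; case: near_box; rewrite ?andbF.
  by apply: count_imp => y yB /= /orP[/(sub _ yB)//|/andP[]].
have hBB : {in A & zbox 0 Lw, forall a w : 'rV[int]_k, a - w \in BB}.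
  move=> a w /AB/mem_zboxP aB /mem_zboxP wW; apply/mem_zboxP => i.
  have Lwn : (Lw i <= n i)%N.
    by rewrite (leq_trans _ (mn i))// (leq_trans _ (Lwm i))// leq_pmull// muln_gt0.
  have := aB i; have := wW i; rewrite !mxE; move: Lwn.
  by move: (a 0 i) (w 0 i) (n i) (Lw i) => b c e f; clear; lia.
have := @sumset_count R k A G rad Lw (dil P m) BB nu D x uA uG AG (zbox_uniq _ _) hD hnu hBB.
rewrite -szW.
set big := inbox _ _; set in2 := inbox (x + x) _.
have eG : count (inbox (x + x) (dil (2 * P) m)) G = count in2 G.
  by apply: eq_count; apply: eq_inbox => i; rewrite /dil mulnA.
rewrite eG -(ler_nat R) !natrM natrX natrD !natrM natrX natrD !natrM -/K => core.
have W0 : 0 < (size W)%:R :> R.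
  by rewrite ltr0n szW prodn_gt0.
have cA : (count (predC big) A)%:R = (size A)%:R - (count big A)%:R :> R.
  by rewrite -(count_predC big A) natrD; ring.
have cG : (count (predC in2) G)%:R = (size G)%:R - (count in2 G)%:R :> R.
  by rewrite -(count_predC in2 G) natrD; ring.
have Dle : D%:R <= k%:R * (2 / q%:R) * (size W)%:R :> R by rewrite /D truncn_le.
have nule : K * nu%:R <= tau / 4 * mu%:R.
  have J0' : 0 < J%:R :> R by rewrite ltr0n.
  rewrite -(ler_pM2l J0').
  have := JP; rewrite ler_pdivrMr// => JP'.
  have : J%:R * nu%:R <= C * mu%:R :> R.
    by apply: le_trans szBB; rewrite -natrM ler_nat.
  have := ler_wpM2r (ler0n R mu) JP'; nra.
have tle : K * ((size BB)%:R * (k%:R * (2 / q%:R))) <= tau / 4 * mu%:R.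
  have : K * (C * mu%:R * (k%:R * (2 / q%:R))) <= tau / 4 * mu%:R.
    have := qP; rewrite ler_pdivrMr// => qP'.
    rewrite !mulrA ler_pdivrMr ?ltr0n//.
    have := ler_wpM2r (ler0n R mu) qP'; lra.
  apply: le_trans; rewrite ler_pM2l// ler_wpM2r ?mulr_ge0 ?invr_ge0//.
have dle : tau / (4 * C) * (size A)%:R <= tau / 4 * mu%:R.
  have -> : tau / 4 * mu%:R = tau / (4 * C) * (C * mu%:R).
    by field; apply: lt0r_neq0.
  by rewrite ler_wpM2l// divr_ge0// ltW// mulr_gt0.
have bigle : K * (count big A)%:R <=
    K * (count (inbox x (dil P m)) A)%:R + tau / 4 * mu%:R.
  have sub a : inbox x (dil P m) a -> big a.
    move=> /inboxP xa; apply/inboxP => i; have := xa i.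
    rewrite !mxE mul2n -addnn !natrD.
    move: (x 0 i) (a 0 i)%:~R (dil P m i)%:R => b c d.
    have : 0 <= (Lw i)%:R :> R by [].
    by move=> ? /andP[? ?]; apply/andP; split; lra.
  have := count_inbox_shell uA sub.
  rewrite prod_dil -/mu -(ler_nat R) !natrD natrM natrX => shell.
  have : (\prod_i (dil P m i + 2 * Lw i + 1))%:R <=
      (P%:R + E'%:R^-1) ^+ k * mu%:R :> R.
    have -> : (P%:R + E'%:R^-1) ^+ k = \prod_(i < k) (P%:R + E'%:R^-1) :> R.
      by rewrite prodr_const card_ord.
    rewrite !natr_prod -big_split/=.
    apply: ler_prod => i _; rewrite ler0n/=.
    have : (3 * Lw i)%:R <= E'%:R^-1 * (m i)%:R :> R.
      by rewrite mulrC ler_pdivlMr ?ltr0n// -natrM ler_nat mulnAC.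
    have : (2 * Lw i + 1)%:R <= (3 * Lw i)%:R :> R.
      by rewrite ler_nat; move: (Lw i) (Lw0 i) => a; clear; lia.
    move=> H1 H2; rewrite -addnA (natrD _ (dil P m i)) /dil natrM mulrDl lerD2l.
    exact: le_trans H1 H2.
  have E'1 : E'%:R^-1 <= 1 :> R by rewrite invf_le1 ?ler1n ?ltr0n.
  have := @exprD_sub_le _ (P%:R : R) E'%:R^-1 (2 * M + 1)%:R k.
  rewrite ler0n invr_ge0 ler0n ler1n addn1 ltnS leq0n => /(_ isT isT).
  have PM' : P%:R + E'%:R^-1 <= (2 * M).+1%:R :> R.
    by rewrite -natr1 lerD// ler_nat.
  move=> /(_ PM' isT) pw.
  have E'2 : K * (k%:R * E'%:R^-1 * (2 * M).+1%:R ^+ k) <= tau / 4.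
    have := E'P; rewrite ler_pdivrMr// addn1 => ?.
    rewrite mulrAC !mulrA ler_pdivrMr ?ltr0n//; lra.
  have mu0 : 0 <= mu%:R :> R by [].
  have := ler_wpM2r mu0 (le_trans (ler_wpM2l (ltW K0) pw) E'2).
  have := ler_wpM2l (ltW K0) shell.
  nra.
have {}core : K * ((size A)%:R - (count big A)%:R) <=
    (size G)%:R - (count in2 G)%:R +
    K * (nu%:R + (size BB)%:R * (k%:R * (2 / q%:R))).
  rewrite -(ler_pM2l W0); move: core; rewrite cA cG.
  have := ler_wpM2l (ler0n R (size BB)) Dle.
  have := @ltW _ _ _ _ K0.
  nra.
move: hG; rewrite -/K; lra.
Qed.
End Homothety.

(** * The set is dense in its hull *)

Section DenseSet.
Variables (R : archiRealFieldType) (k : nat).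
Variables (A G : seq 'rV[int]_k) (m : 'I_k -> nat) (J : nat) (tau : R).
Hypotheses (k1 : (0 < k)%N) (m0 : forall i, (0 < m i)%N).
Hypothesis uA : uniq A.
Hypothesis AG : {in A &, forall a b : 'rV[int]_k, a + b \in G}.
Local Notation mu := (\prod_i m i)%N.
Local Notation N x P := (count (inbox x (dil P m)) A)%:R.
Local Notation pt := (map_mx intr : 'rV[int]_k -> 'rV[R]_k).
Hypothesis tau0 : 0 <= tau.
Hypothesis doublingG : forall (x : 'rV[R]_k) (P : nat), (P <= 2 * 2 ^ J)%N ->
  (count (inbox (x + x) (dil (2 * P) m)) G)%:R <=
  2 ^+ k * N x P + tau * mu%:R.

Lemma inbox_shift (x : 'rV[R]_k) L (a b : 'rV[int]_k) :
  inbox (x + pt a) L (a + b) = inbox x L b.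
Proof.
apply: eq_forallb => i; rewrite !mxE intrD.
by move: (x 0 i) (a 0 i)%:~R (b 0 i)%:~R => c d e; apply/idP/idP => /andP[? ?];
  apply/andP; split; lra.
Qed.

(** Translation by [a] sends [A] into [G] and the box at [x] onto the double of the box at the
    midpoint of [x] and [a]. *)
Lemma homothety (a : 'rV[int]_k) (x : 'rV[R]_k) P : a \in A ->
  (P <= 2 * 2 ^ J)%N ->
  N x (2 * P) <= 2 ^+ k * N (2^-1 *: (x + pt a)) P + tau * mu%:R.
Proof.
move=> aA PJ; apply: le_trans (doublingG _ PJ); rewrite ler_nat.
apply: (@count_inj _ _ (fun b => a + b)) => // [b b' _ _ _ _ /addrI//|b bA xb].
have -> : 2^-1 *: (x + pt a) + 2^-1 *: (x + pt a) = x + pt a.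
  by rewrite -scalerDl -[RHS]scale1r; congr (_ *: _); field.
by rewrite AG//= inbox_shift.
Qed.

Variables (n : 'I_k -> nat) (eps : R).
Hypotheses (An : {subset A <= zbox 0 n}) (nm : forall i, (n i <= 2 * 2 ^ J * m i)%N).
Hypothesis epsA : eps * (2 ^ J)%:R ^+ k * mu%:R <= (size A)%:R.

(** Start from a box of 2^(J+1) cells containing all of [A] and contract it repeatedly towards [a]
    by 1/2; the fixed point [a] never leaves the box. *)
Lemma dense_box_iter (a : 'rV[int]_k) i : a \in A -> (i <= J.+1)%N ->
  exists2 x : 'rV[R]_k, inbox x (dil (2 ^ (J.+1 - i)) m) a &
  (size A)%:R <= 2 ^+ (i * k) * (N x (2 ^ (J.+1 - i)) + tau * mu%:R).
Proof.
move=> aA; elim: i => [_|i IH iJ].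
  have inA b : b \in A -> inbox (0 : 'rV[R]_k) (dil (2 ^ (J.+1 - 0)) m) b.
    move=> /An/mem_zboxP bn; apply/inboxP => i; have := bn i; have := nm i.
    rewrite !mxE /dil subn0 expnS !add0r => nmi.
    rewrite ler0z -[(_ * m i)%:R]/((_ * m i)%N%:Z%:~R) ltr_int.
    by move: (b 0 i) (n i) (2 * 2 ^ J * m i)%N nmi => c d e; clear; lia.
  exists 0; first exact: inA.
  rewrite mul0n expr0 mul1r -[leLHS]addr0 lerD ?mulr_ge0// ler_nat.
  by rewrite -count_predT; apply: count_imp => b bA _; exact: inA.
have [x xa sx] := IH (ltnW iJ).
have e2 : (J.+1 - i = (J.+1 - i.+1).+1)%N by rewrite subnSK.
exists (2^-1 *: (x + pt a)).
  apply/inboxP => l; move/inboxP: xa => /(_ l).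
  rewrite !mxE e2 /dil expnS -mulnA mul2n -addnn natrD.
  move: (x 0 l) (a 0 l)%:~R (_ * _)%:R => b c d.
  by move=> /andP[? ?]; apply/andP; split; lra.
apply: (le_trans sx); rewrite mulSn addnC exprD -mulrA ler_wpM2l ?exprn_ge0//.
rewrite e2 expnS.
have PJ : (2 ^ (J.+1 - i.+1) <= 2 * 2 ^ J)%N.
  by rewrite -expnS leq_exp2l// leq_subr.
have := homothety x aA PJ.
(* The error is absorbed in the bracket: from N <= 2^k N' + e follows N + e <= 2^k (N' + e), since 2
   <= 2^k. *)
have : 2 <= 2 ^+ k :> R.
  by case: k k1 => // k' _; rewrite exprS ler_peMr// exprn_ege1// ler1n.
have : 0 <= tau * mu%:R by rewrite mulr_ge0.
nra.
Qed.

Lemma dense_box (a : 'rV[int]_k) j : a \in A -> (j <= J.+1)%N ->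
  exists2 x : 'rV[R]_k, inbox x (dil (2 ^ j) m) a &
  eps * (2 ^ j)%:R ^+ k * mu%:R <= 2 ^+ k * (N x (2 ^ j) + tau * mu%:R).
Proof.
move=> aA jJ; have [x] := dense_box_iter aA (leq_subr j J.+1).
rewrite subKn// => xa xA; exists x => //.
have [i iE] : exists i, (J.+1 = i + j)%N by exists (J.+1 - j)%N; rewrite subnK.
have := le_trans epsA xA; rewrite {1}iE addnK => le1.
have i0 : 0 < 2 ^+ (i * k) :> R by rewrite exprn_gt0.
rewrite -(ler_pM2l i0) [leRHS]mulrCA.
have -> : 2 ^+ (i * k) * (eps * (2 ^ j)%:R ^+ k * mu%:R) =
    2 ^+ k * (eps * (2 ^ J)%:R ^+ k * mu%:R) :> R.
  rewrite !natrX -!exprM.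
  have E : 2 ^+ (i * k) * 2 ^+ (j * k) = 2 ^+ k * 2 ^+ (J * k) :> R.
    by rewrite -!exprD -mulnDl -iE mulSn.
  move: E; move: (2 ^+ (i * k)) (2 ^+ (j * k)) (2 ^+ k) (2 ^+ (J * k)) => e f g h E.
  transitivity (e * f * (eps * mu%:R)); first by ring.
  by rewrite E; ring.
by rewrite ler_wpM2l ?exprn_ge0.
Qed.

Hypothesis eps1 : 2 * tau < eps.
Hypothesis mu0 : (0 < mu)%N.

(** A box of two cells around [y] has more than [tau * mu] points of [A]; contracting it towards [z]
    gives a box of one cell around the midpoint, which cannot be empty. *)
Lemma midpoint_near (y z : 'rV[int]_k) : y \in A -> z \in A ->
  exists2 w : 'rV[int]_k, w \in A &
  forall i, `|(w 0 i)%:~R - ((y 0 i)%:~R + (z 0 i)%:~R) / 2| <= (m i)%:R :> R.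
Proof.
move=> yA zA; have [x xy] := dense_box (j := 1) yA (ltn0Sn J).
rewrite expn1 -[(2 ^+ k)]/((2%:R : R) ^+ k) => dx.
have K0 : 0 < 2 ^+ k :> R by rewrite exprn_gt0.
have mu0' : 0 < mu%:R :> R by rewrite ltr0n.
have {}dx : eps * mu%:R <= N x 2 + tau * mu%:R.
  by rewrite -(ler_pM2l K0); apply: le_trans dx; rewrite !mulrA (mulrC eps).
have J1 : (1 <= 2 * 2 ^ J)%N by rewrite muln_gt0 expn_gt0.
have hom := @homothety z x 1 zA J1.
have : (0 : R) < N (2^-1 *: (x + pt z)) 1.
  rewrite -(pmulr_rgt0 _ K0); move: hom; rewrite muln1.
  have : 2 * tau * mu%:R < eps * mu%:R by rewrite ltr_pM2r.
  lra.
rewrite ltr0n -has_count => /hasP[w wA /inboxP wx]; exists w => // i.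
have := wx i; move/inboxP: xy => /(_ i); rewrite !mxE /dil mul1n.
rewrite mul2n -addnn natrD ler_norml.
move: (x 0 i) (w 0 i)%:~R (y 0 i)%:~R (z 0 i)%:~R (m i)%:R => a b c d e.
by move=> /andP[? ?] /andP[? ?]; apply/andP; split; lra.
Qed.

(** Each bisection towards [a] halves the previous error and adds one cell, so the error never
    exceeds two cells. *)
Lemma segment_near (a b : 'rV[int]_k) j : a \in A -> b \in A ->
  exists2 w : 'rV[int]_k, w \in A & forall i,
  `|(w 0 i)%:~R - ((a 0 i)%:~R + 2^-1 ^+ j * ((b 0 i)%:~R - (a 0 i)%:~R))|
    <= 2 * (m i)%:R :> R.
Proof.
move=> aA bA; elim: j => [|j [w wA wj]].
  by exists b => // i; rewrite expr0 mul1r subrKC subrr normr0 mulr_ge0.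
have [v vA vw] := midpoint_near aA wA; exists v => // i.
move: (wj i) (vw i); rewrite exprS -!mulrA !ler_norml; move: (_ * (_ - _)).
move: (w 0 i)%:~R (v 0 i)%:~R (a 0 i)%:~R (m i)%:R => c d e f g.
by move=> /andP[? ?] /andP[? ?]; apply/andP; split; lra.
Qed.

Lemma dyadic_below (T : R) : 0 < T ->
  exists2 j, 2^-1 ^+ j <= T & (j = 0%N \/ T < 2 * 2^-1 ^+ j).
Proof.
move=> T0; have ex : exists j, 2^-1 ^+ j <= T.
  have [r r0 Tr] := nat_above T^-1; exists r.
  rewrite exprVn invf_ple ?posrE ?exprn_gt0//.
  by apply: le_trans Tr _; rewrite -natrX ler_nat ltnW// ltn_expl.
exists (ex_minn ex); case: ex_minnP => // -[|j] _ jmin; first by left.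
right; rewrite exprS mulrA mulfV ?pnatr_eq0// mul1r ltNge; apply/negP => /jmin.
by rewrite ltnn.
Qed.

Lemma seq_argmin (T : eqType) (s : seq T) (f : T -> R) : s != [::] ->
  exists2 x, x \in s & {in s, forall y, f x <= f y}.
Proof.
elim: s => // a [|b s] IH _.
  by exists a; rewrite ?inE// => y; rewrite inE => /eqP ->.
have [x xs xmin] := IH isT.
have [fax|fxa] := leP (f a) (f x).
  exists a; first exact: mem_head.
  move=> y; rewrite in_cons => /orP[/eqP-> //|/xmin]; exact: le_trans.
exists x; first by rewrite in_cons xs orbT.
by move=> y; rewrite in_cons => /orP[/eqP->|/xmin //]; exact: ltW.
Qed.

(* Let [a] be a point of [A] closest to [x] for a Euclidean norm. If it were far
   away, then some [b] in [A] would lie in the half-space beyond [x], and a point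
   of [A] near the segment from [a] to [b] would be closer. *)
Lemma hull_near (x : 'rV[R]_k) (D : nat) : A != [::] ->
  (forall c : 'rV[R]_k,
     exists2 b : 'rV[int]_k, b \in A & \sum_i c 0 i * ((b 0 i)%:~R - x 0 i) <= 0) ->
  (24 * k <= D ^ 2)%N -> (1536 * k ^ 3 * (2 ^ J) ^ 4 <= D ^ 6)%N ->
  exists2 w : 'rV[int]_k, w \in A &
    forall i, `|(w 0 i)%:~R - x 0 i| <= (D * m i)%:R.
Proof.
move=> A0 hull D1 D2.
pose q (y : 'rV[R]_k) : R := \sum_i (y 0 i / (m i)%:R) ^+ 2.
have [a aA amin] := seq_argmin (fun a => q (pt a - x)) A0.
set H := q (pt a - x) in amin.
suff HD : H <= D%:R ^+ 2.
  exists a => // i; rewrite natrM -ler_pdivrMr ?ltr0n//.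
  rewrite -[X in _ / X]gtr0_norm ?ltr0n// -normf_div.
  rewrite -(@ler_pXn2r _ 2) ?nnegrE// real_normK ?num_real//.
  apply: le_trans HD; rewrite /H /q (bigD1 i)//= !mxE lerDl.
  by apply: sumr_ge0 => j _; exact: sqr_ge0.
rewrite leNgt; apply/negP => HD.
have H0 : 0 < H by apply: le_lt_trans HD; exact: sqr_ge0.
(* Bound for the squared length, in cells, of a segment joining two points of [A]. *)
pose R2 : R := 4 * k%:R * (2 ^ J)%:R ^+ 2.
have R20 : 0 < R2 by rewrite !mulr_gt0 ?exprn_gt0 ?ltr0n ?expn_gt0.
(* Moving by the ratio [t] towards [b] leaves a squared distance of at most H - 2 t H + t^2 R2,
   minimal at t = H / R2; since only dyadic ratios are available, this value is rounded down. *)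
have [j tT tj] := dyadic_below (divr_gt0 H0 R20).
set t := 2^-1 ^+ j in tT tj.
have t0 : 0 < t by rewrite exprn_gt0// invr_gt0.
have t1 : t <= 1 by rewrite exprn_ile1// ?invr_ge0// invf_le1// ler1n.
have tR2 : t * R2 <= H by rewrite -ler_pdivlMr.
have [b bA ab] := hull (\row_i (((a 0 i)%:~R - x 0 i) / (m i)%:R ^+ 2)).
have [w wA wab] := segment_near j aA bA.
pose al i : R := ((a 0 i)%:~R - x 0 i) / (m i)%:R.
pose be i : R := ((b 0 i)%:~R - (a 0 i)%:~R) / (m i)%:R.
pose om i : R := ((w 0 i)%:~R - ((a 0 i)%:~R + t * ((b 0 i)%:~R - (a 0 i)%:~R)))
  / (m i)%:R.
have mi0 i : 0 < (m i)%:R :> R by rewrite ltr0n.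
have HE : H = \sum_i al i ^+ 2 by apply: eq_bigr => i _; rewrite !mxE.
have qw : q (pt w - x) = \sum_i (al i + t * be i + om i) ^+ 2.
  apply: eq_bigr => i _; rewrite !mxE /al /be /om; congr (_ ^+ 2).
  by field; rewrite lt0r_neq0.
have om2 : \sum_i om i ^+ 2 <= 4 * k%:R.
  have -> : 4 * k%:R = \sum_(i < k) (4 : R) by rewrite sumr_const card_ord mulr_natr.
  apply: ler_sum => i _; rewrite -real_normK ?num_real//.
  have : `|om i| <= 2.
    by rewrite normf_div (gtr0_norm (mi0 i)) ler_pdivrMr// wab.
  have := normr_ge0 (om i); nra.
have be2 : \sum_i be i ^+ 2 <= R2.
  have -> : R2 = \sum_(i < k) (4 * (2 ^ J)%:R ^+ 2 : R).
    by rewrite sumr_const card_ord -[RHS]mulr_natr /R2; ring.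
  apply: ler_sum => i _; rewrite -real_normK ?num_real//.
  have : `|be i| <= 2 * (2 ^ J)%:R.
    rewrite normf_div (gtr0_norm (mi0 i)) ler_pdivrMr// -intrB -intr_norm.
    rewrite -!natrM -[leRHS]/((2 * 2 ^ J * m i)%N%:Z%:~R) ler_int.
    move/An/mem_zboxP: aA => /(_ i); move/An/mem_zboxP: bA => /(_ i).
    have := nm i; rewrite !mxE; move: (a 0 i) (b 0 i) (n i) (2 * 2 ^ J * m i)%N.
    by move=> c d e f; clear; lia.
  have := normr_ge0 (be i); have : 0 <= (2 ^ J)%:R :> R by [].
  nra.
have albe : \sum_i al i * be i <= - H.
  rewrite HE -subr_ge0 -opprD oppr_ge0 -big_split/=; apply: le_trans ab.
  apply: ler_sum => i _; rewrite !mxE /al /be le_eqVlt; apply/orP; left.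
  by apply/eqP; field; rewrite lt0r_neq0.
have t2 : 0 < t / 2 by rewrite divr_gt0.
(* Coordinatewise, (X + Y)^2 <= (1 + t / 2) X^2 + (1 + 2 / t) Y^2, with [Y] the error of the segment
   approximation; the difference is a multiple of a square. *)
have key : H <= (1 + t / 2) * (H + 2 * t * \sum_i al i * be i +
    t ^+ 2 * \sum_i be i ^+ 2) + (1 + 2 / t) * \sum_i om i ^+ 2.
  apply: (le_trans (amin _ wA)); rewrite qw HE !mulr_sumr -!big_split/=.
  rewrite mulr_sumr -big_split/=; apply: ler_sum => i _.
  rewrite -subr_ge0.
  have -> : (1 + t / 2) * (al i ^+ 2 + 2 * t * (al i * be i) + t ^+ 2 * be i ^+ 2) +
     (1 + 2 / t) * om i ^+ 2 - (al i + t * be i + om i) ^+ 2 =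
     (t / 2) * (al i + t * be i - 2 / t * om i) ^+ 2.
    by field; rewrite lt0r_neq0.
  by rewrite mulr_ge0 ?sqr_ge0 ?ltW.
have t2H : t ^+ 2 * H <= 24 * k%:R.
  have k0 : 0 <= k%:R :> R by [].
  have u1 : H + 2 * t * \sum_i al i * be i + t ^+ 2 * \sum_i be i ^+ 2 <= H - t * H.
    have : t ^+ 2 * \sum_i be i ^+ 2 <= t * H.
      rewrite expr2 -mulrA ler_wpM2l ?(ltW t0)//; apply: le_trans tR2.
      by rewrite ler_wpM2l ?(ltW t0).
    have : t * \sum_i al i * be i <= t * - H by rewrite ler_wpM2l ?(ltW t0).
    by lra.
  have u2 : (1 + 2 / t) * \sum_i om i ^+ 2 <= (1 + 2 / t) * (4 * k%:R).
    by rewrite ler_wpM2l// addr_ge0// divr_ge0 ?ltW.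
  have u3 : (1 + t / 2) * (H + 2 * t * \sum_i al i * be i +
    t ^+ 2 * \sum_i be i ^+ 2) <= (1 + t / 2) * (H - t * H).
    by rewrite ler_wpM2l// addr_ge0// ltW.
  have u4 : H <= (1 + t / 2) * (H - t * H) + (1 + 2 / t) * (4 * k%:R).
    by lra.
  have u5 : 2 * t * ((1 + 2 / t) * (4 * k%:R)) = (2 * t + 4) * (4 * k%:R).
    by field; rewrite lt0r_neq0.
  have u6 : 0 <= t ^+ 3 * H.
    by apply: mulr_ge0; [apply: exprn_ge0|]; apply: ltW.
  have u7 : 2 * t * H <= 2 * t * ((1 + t / 2) * (H - t * H)) +
      2 * t * ((1 + 2 / t) * (4 * k%:R)).
    by rewrite -mulrDr ler_wpM2l// mulr_ge0// ltW.
  have u8 : t * k%:R <= k%:R by rewrite ler_piMl.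
  by rewrite u5 in u7; lra.
have D1' : 24 * k%:R <= D%:R ^+ 2 :> R by rewrite -natrX -natrM ler_nat.
have D2' : 1536 * k%:R ^+ 3 * ((2 ^ J)%:R ^+ 4) <= D%:R ^+ 6 :> R.
  by rewrite -!natrX -!natrM ler_nat.
(* If t = 1, then H <= 24 k directly. Otherwise H < 2 t R2, and together with t^2 H <= 24 k this
   gives H^3 < 96 k R2^2. This is where [D] of order 2^(2J/3) comes from. *)
case: tj => [j0|tj].
  by move: t2H; rewrite /t j0 expr0 expr1n mul1r; lra.
have {}tj : H < 2 * t * R2 by rewrite -ltr_pdivrMr.
have H2 : H ^+ 2 < 4 * t ^+ 2 * R2 ^+ 2.
  have -> : 4 * t ^+ 2 * R2 ^+ 2 = (2 * t * R2) ^+ 2 by ring.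
  by rewrite ltrXn2r//?nnegrE ltW.
have H3 : H ^+ 3 < 96 * k%:R * R2 ^+ 2.
  have R22 : 0 < R2 ^+ 2 by rewrite exprn_gt0.
  rewrite exprS; apply: (@lt_le_trans _ _ (H * (4 * t ^+ 2 * R2 ^+ 2))).
    by rewrite ltr_pM2l.
  have -> : H * (4 * t ^+ 2 * R2 ^+ 2) = 4 * R2 ^+ 2 * (t ^+ 2 * H) by ring.
  have -> : 96 * k%:R * R2 ^+ 2 = 4 * R2 ^+ 2 * (24 * k%:R) by ring.
  by rewrite ler_pM2l// mulr_gt0.
have : D%:R ^+ 6 < H ^+ 3.
  by rewrite (exprM _ 2 3) ltrXn2r// ?nnegrE ?exprn_ge0// ltW.
move: H3; rewrite (_ : 96 * k%:R * R2 ^+ 2 = 1536 * k%:R ^+ 3 * ((2 ^ J)%:R ^+ 4)).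
  by lra.
by rewrite /R2; ring.
Qed.
End DenseSet.

(** * The density is nearly constant *)

Section Interior.
Variables (R : archiRealFieldType) (k : nat) (m : 'I_k -> nat).
Variable K : pred 'rV[R]_k.
Hypothesis convK : forall x y (t : R), 0 <= t <= 1 -> K x -> K y ->
  K (t *: x + (1 - t) *: y).

Definition Kin (Q : nat) (x : 'rV[R]_k) : Prop :=
  forall u : 'rV[R]_k, (forall i, `|u 0 i| <= (Q * m i)%:R) -> K (x + u).

Lemma Kin_sub Q Q' x : (Q <= Q')%N -> Kin Q' x -> Kin Q x.
Proof.
move=> QQ' Kx u uQ; apply: Kx => i; apply: le_trans (uQ i) _.
by rewrite ler_nat leq_mul2r QQ' orbT.
Qed.

Lemma Kin_mem Q x : Kin Q x -> K x.
Proof.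
by move=> /(_ 0); rewrite addr0; apply=> i; rewrite mxE normr0.
Qed.

Lemma Kin_shift Q Q' (x y : 'rV[R]_k) : Kin (Q + Q') x ->
  (forall i, `|y 0 i - x 0 i| <= (Q' * m i)%:R) -> Kin Q y.
Proof.
move=> Kx yx u uQ; have -> : y + u = x + (y - x + u).
  by rewrite addrA subrKC.
apply: Kx => i; rewrite !mxE mulnDl natrD (le_trans (ler_normD _ _))//.
by have := yx i; have := uQ i; lra.
Qed.

Lemma mid_mem x y : K x -> K y -> K (2^-1 *: (x + y)).
Proof.
move=> Kx Ky; have := @convK x y 2^-1 _ Kx Ky.
have -> : 1 - 2^-1 = 2^-1 :> R by field.
by rewrite scalerDr; apply; apply/andP; split; lra.
Qed.

Lemma Kin_mid Q x y : Kin Q x -> Kin Q y -> Kin Q (2^-1 *: (x + y)).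
Proof.
move=> Kx Ky u uQ.
have -> : 2^-1 *: (x + y) + u = 2^-1 *: ((x + u) + (y + u)).
  by apply/rowP => i; rewrite !mxE; field.
by apply: mid_mem; [apply: Kx|apply: Ky].
Qed.

Lemma Kin_half Q x y : K x -> Kin (2 * Q) y -> Kin Q (2^-1 *: (x + y)).
Proof.
move=> Kx Ky u uQ.
have -> : 2^-1 *: (x + y) + u = 2^-1 *: (x + (y + 2 *: u)).
  by apply/rowP => i; rewrite !mxE; field.
apply: mid_mem => //; apply: Ky => i; rewrite mxE normrM normr_nat -mulnA natrM.
by rewrite ler_wpM2l.
Qed.

(** A box is the convex hull of its vertices. The induction frees one coordinate at a time: those of
    index at least [j] are still at an endpoint. *)
Lemma Kin_corners Q x :
  (forall e : {ffun 'I_k -> bool}, K (x + \row_i ((-1) ^+ e i * (Q * m i)%:R))) ->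
  Kin Q x.
Proof.
move=> corner.
suff H : forall j (u : 'rV[R]_k), (j <= k)%N ->
    (forall i, `|u 0 i| <= (Q * m i)%:R) ->
    (forall i : 'I_k, (j <= i)%N -> `|u 0 i| = (Q * m i)%:R) -> K (x + u).
  by move=> u uQ; apply: (H k) => // i; rewrite leqNgt ltn_ord.
elim=> [|j IH] u jk uQ uj.
  have -> : u = \row_i ((-1) ^+ [ffun i : 'I_k => u 0 i < 0] i * (Q * m i)%:R).
    apply/rowP => i; rewrite mxE ffunE -(uj i)//.
    have [u0|u0] := ltrP (u 0 i) 0.
      by rewrite expr1 mulN1r ltr0_norm// opprK.
    by rewrite expr0 mul1r ger0_norm.
  exact: corner.
pose o := Ordinal jk; pose q : R := (Q * m o)%:R.
have q0 : 0 <= q by [].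
have [q00|qn0] := eqVneq q 0.
  apply: IH => //; first exact: ltnW.
  move=> i; rewrite leq_eqVlt => /orP[/eqP ji|]; last exact: uj.
  have -> : i = o by apply/val_inj.
  by apply/eqP; rewrite eq_le uQ /= -/q q00.
have qgt : 0 < q by rewrite lt0r qn0.
pose v c : 'rV[R]_k := \row_i (if i == o then c else u 0 i).
have Kv c : `|c| = q -> K (x + v c).
  move=> cq; apply: IH; first exact: ltnW.
    by move=> i; rewrite mxE; case: eqP => [->|_]; rewrite ?cq ?uQ.
  move=> i ji; rewrite mxE; case: eqP => [->//|/eqP io].
  by apply: uj; rewrite ltn_neqAle ji andbT eq_sym; apply: contra io => /eqP e;
    apply/eqP/val_inj.
have uo : - q <= u 0 o <= q by rewrite -ler_norml uQ.
pose t := (u 0 o + q) / (2 * q).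
have -> : x + u = t *: (x + v q) + (1 - t) *: (x + v (- q)).
  apply/rowP => i; rewrite !mxE /t; move: (q) qn0 => q' qn0'.
  by case: eqP => [->|_]; field.
apply: convK; last by apply: Kv; rewrite normrN gtr0_norm.
  apply/andP; split; first by rewrite divr_ge0; lra.
  by rewrite ler_pdivrMr; lra.
by apply: Kv; rewrite gtr0_norm.
Qed.

End Interior.

(** * Comparing boxes through homotheties centred in the hull *)

Section ConstantDensity.
Variables (R : archiRealFieldType) (k : nat).
Variables (A : seq 'rV[int]_k) (m : 'I_k -> nat) (J D : nat) (tau : R).
Hypothesis uA : uniq A.
Local Notation mu := (\prod_i m i)%N.
Local Notation N x P := (count (inbox x (dil P m)) A)%:R.
Local Notation pt := (map_mx intr : 'rV[int]_k -> 'rV[R]_k).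
Hypothesis tau0 : 0 <= tau.
Hypothesis homA : forall (a : 'rV[int]_k) (x : 'rV[R]_k) P, a \in A ->
  (P <= 2 * 2 ^ J)%N ->
  N x (2 * P) <= 2 ^+ k * N (2^-1 *: (x + pt a)) P + tau * mu%:R.
Variable K : pred 'rV[R]_k.
Hypothesis convK : forall x y (t : R), 0 <= t <= 1 -> K x -> K y ->
  K (t *: x + (1 - t) *: y).
Hypothesis nearK : forall x : 'rV[R]_k, K x -> exists2 w : 'rV[int]_k, w \in A &
  forall i, `|(w 0 i)%:~R - x 0 i| <= (D * m i)%:R.
Hypothesis boxK : forall x y : 'rV[R]_k, K x -> K y ->
  forall i, `|x 0 i - y 0 i| <= (2 * 2 ^ J * m i)%:R.

(** Price of one homothety whose centre is a point of the hull: the centre is replaced by a point of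
    [A] at most [D] cells away. *)
Definition err P : R := tau + 2 ^+ k * ((P + 2 * D)%:R ^+ k - P%:R ^+ k).

Lemma shell_ge0 P d : 0 <= (P + d)%:R ^+ k - P%:R ^+ k :> R.
Proof. by rewrite subr_ge0 lerXn2r ?nnegrE// ler_nat leq_addr. Qed.

Lemma err_ge0 P : 0 <= err P.
Proof. by rewrite addr_ge0// mulr_ge0 ?exprn_ge0// shell_ge0. Qed.

Lemma homothety_hull kap x P : K kap -> (P <= 2 * 2 ^ J)%N ->
  N x (2 * P) <= 2 ^+ k * N (2^-1 *: (x + kap)) P + err P * mu%:R.
Proof.
move=> Kk PJ; have [w wA wk] := nearK Kk.
apply: (le_trans (homA x wA PJ)).
have := @count_inbox_lip R k A (2^-1 *: (x + pt w)) (2^-1 *: (x + kap)) m P D uA.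
have near2 i : `|(2^-1 *: (x + pt w)) 0 i - (2^-1 *: (x + kap)) 0 i| <= (D * m i)%:R.
  have -> : (2^-1 *: (x + pt w)) 0 i - (2^-1 *: (x + kap)) 0 i =
     2^-1 * ((w 0 i)%:~R - kap 0 i) by rewrite !mxE; field.
  rewrite normrM ger0_norm ?invr_ge0//.
  by have := wk i; have := normr_ge0 ((w 0 i)%:~R - kap 0 i); lra.
move=> /(_ near2) lip.
have K0 : 0 <= 2 ^+ k :> R by rewrite exprn_ge0.
have := ler_wpM2l K0 lip; rewrite /err; lra.
Qed.

(** Each of the 2^k subboxes is the image of the large box under a homothety centred in the hull, so
    each holds nearly its share. As their total is at most the large count, the one at the corner
    [x] cannot hold much more than its share. *)
Lemma subbox_upper x P : Kin m K (2 * P) x -> (P <= 2 * 2 ^ J)%N ->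
  2 ^+ k * N x P <= N x (2 * P) + 2 ^+ k * (err P * mu%:R).
Proof.
move=> Kx PJ.
pose E (e : {ffun 'I_k -> bool}) := \row_i (e i * (P * m i))%:R : 'rV[R]_k.
have sub e : N x (2 * P) <= 2 ^+ k * N (x + E e) P + err P * mu%:R.
  have KE : K (x + 2 *: E e).
    apply: Kx => i; rewrite !mxE ger0_norm ?mulr_ge0// -natrM ler_nat.
    by case: (e i); rewrite ?mul1n ?mul0n ?muln0 ?mulnA.
  have mid : 2^-1 *: (x + (x + 2 *: E e)) = x + E e.
    by apply/rowP => i; rewrite !mxE; field.
  by have := homothety_hull x KE PJ; rewrite mid.
have := count_subboxes A x m P; rewrite -(ler_nat R) natr_sum.
pose e0 : {ffun 'I_k -> bool} := [ffun=> false].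
have E0 : x + E e0 = x.
  by apply/rowP => i; rewrite !mxE ffunE mul0n addr0.
rewrite (bigD1 e0)//= -/(E e0) E0.
set S := \sum_(e | _) _ => H.
have : (2 ^+ k - 1) * (N x (2 * P) - err P * mu%:R) <= 2 ^+ k * S.
  rewrite mulr_sumr.
  have -> : (2 ^+ k - 1) * (N x (2 * P) - err P * mu%:R) =
      \sum_(e | e != e0) (N x (2 * P) - err P * mu%:R).
    rewrite sumr_const cardC1 card_ffun card_bool card_ord.
    by rewrite -[RHS]mulr_natl -subn1 natrB ?expn_gt0// natrX.
  by apply: ler_sum => e _; rewrite lerBlDr; exact: sub.
have K0 : 0 <= 2 ^+ k :> R by rewrite exprn_ge0.
have e1 : 0 <= err P * mu%:R by rewrite mulr_ge0// err_ge0.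
by have := ler_wpM2l K0 H; rewrite mulrDr; lra.
Qed.

Lemma density_mid x kap P : Kin m K (2 * P) x -> K kap -> (P <= 2 * 2 ^ J)%N ->
  N x P <= N (2^-1 *: (x + kap)) P + 2 * err P * mu%:R.
Proof.
move=> Kx Kk PJ; have K1 : 1 <= 2 ^+ k :> R by rewrite exprn_ege1// ler1n.
have := subbox_upper Kx PJ; have := homothety_hull x Kk PJ.
have e1 : 0 <= err P * mu%:R by rewrite mulr_ge0// err_ge0.
have K0 : 0 < 2 ^+ k :> R by rewrite exprn_gt0.
rewrite -(ler_pM2l K0 (N x P)).
nra.
Qed.

(** Error of [J + 1] midpoint moves, which reduce a distance of at most 2^(J+1) cells to one cell,
    followed by a shift by one cell. *)
Definition rho P : R := 2 * J.+1%:R * err P + ((P + 2)%:R ^+ k - P%:R ^+ k).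

Lemma density_const x y P : Kin m K (2 * P) x -> Kin m K (2 * P) y ->
  (P <= 2 * 2 ^ J)%N -> N x P <= N y P + rho P * mu%:R.
Proof.
move=> Kx Ky PJ.
have H j : exists2 z, Kin m K (2 * P) z &
   (forall i, z 0 i - y 0 i = 2^-1 ^+ j * (x 0 i - y 0 i)) /\
   N x P <= N z P + j%:R * (2 * err P) * mu%:R.
  elim: j => [|j [z Kz [zE zN]]].
    by exists x => //; split=> [i|]; rewrite ?expr0 ?mul1r// !mul0r addr0.
  exists (2^-1 *: (z + y)); first exact: Kin_mid.
  split=> [i|].
    by rewrite exprS -mulrA -zE !mxE; field.
  have := density_mid Kz (Kin_mem Ky) PJ; rewrite -natr1; lra.
have [z Kz [zE zN]] := H J.+1.
have zy i : `|z 0 i - y 0 i| <= (1 * m i)%:R.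
  rewrite zE normrM ger0_norm ?exprn_ge0 ?invr_ge0// exprVn mulrC ler_pdivrMr ?exprn_gt0//.
  apply: (le_trans (boxK (Kin_mem Kx) (Kin_mem Ky) i)).
  by rewrite -natrX -natrM ler_nat mul1n mulnC expnS.
have := count_inbox_lip P uA zy; rewrite muln1 /rho; lra.
Qed.

End ConstantDensity.

(** * The lattice of almost-periods *)

Lemma count_disjoint (T T' : eqType) (f g : T -> T') (s : seq T) (t : seq T')
    (P Q : pred T) (S : pred T') : uniq s -> injective f -> injective g ->
  {in s, forall x, P x -> (f x \in t) && S (f x)} ->
  {in s, forall x, Q x -> (g x \in t) && S (g x)} ->
  {in s &, forall x y, P x -> Q y -> f x <> g y} ->
  (count P s + count Q s <= count S t)%N.
Proof.
move=> us fi gi fP gQ fg; rewrite -!size_filter.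
rewrite -(size_map f) -(size_map g) -size_cat.
apply: uniq_leq_size.
  rewrite cat_uniq !map_inj_uniq ?filter_uniq//= andbT.
  apply/hasPn => _ /mapP[y + ->]; rewrite mem_filter => /andP[Qy ys].
  apply/negP => /mapP[x]; rewrite mem_filter => /andP[Px xs] /esym.
  exact: fg.
move=> z; rewrite mem_cat mem_filter => /orP[] /mapP[x] + ->;
  rewrite mem_filter => /andP[xP xs].
  by have /andP[-> ->] := fP _ xs xP.
by have /andP[-> ->] := gQ _ xs xP.
Qed.

Section PeriodLattice.
Variables (R : archiRealFieldType) (k : nat).
Variables (A G : seq 'rV[int]_k) (m : 'I_k -> nat) (P : nat) (T theta beta : R).
Hypotheses (m0 : forall i, (0 < m i)%N) (uA : uniq A).
Hypothesis AG : {in A &, forall a b : 'rV[int]_k, a + b \in G}.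
Local Notation mu := (\prod_i m i)%N.
Local Notation N x P := (count (inbox x (dil P m)) A)%:R.
Local Notation pt := (map_mx intr : 'rV[int]_k -> 'rV[R]_k).
Variable K : pred 'rV[R]_k.
Hypothesis convK : forall x y (t : R), 0 <= t <= 1 -> K x -> K y ->
  K (t *: x + (1 - t) *: y).
Hypothesis AK : {in A, forall a : 'rV[int]_k, K (pt a)}.
Local Notation Kin := (Kin m K).
(** [T * mu] stands for the common count of [A] in interior boxes of [16 * P] cells and of [G] in
    doubles of interior boxes of [8 * P] cells, up to [theta * mu]; [beta * mu] is a crude lower
    count at the smaller size [P]. *)
Hypothesis lowA : forall x, Kin (16 * P) x -> (T - theta) * mu%:R <= N x (16 * P).
Hypothesis upG : forall x : 'rV[R]_k, Kin (16 * P) x ->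
  (count (inbox (x + x) (dil (16 * P) m)) G)%:R <= (T + theta) * mu%:R.
Hypothesis smallA : forall x, Kin (16 * P) x -> beta * mu%:R <= N x P.
Hypotheses (theta0 : 0 <= theta) (theta_beta : 4 * theta < beta).
Variable y0 : 'rV[R]_k.
Hypothesis y0K : Kin (160 * P) y0.

Let mu0 : 0 < mu%:R :> R.
Proof. by rewrite ltr0n prodn_gt0. Qed.

Lemma natr_dil c i : (c * P * m i)%:R = c%:R * (P * m i)%:R :> R.
Proof. by rewrite -mulnA natrM. Qed.

Definition bad (t : 'rV[int]_k) (y : 'rV[R]_k) : nat :=
  count (fun b => ((b + t)%R \notin A) && inbox y (dil (8 * P) m) (b + t)%R) A.

(* Both [a + A] and [a' + A] fill the same part of [G] near [x + y], up to
   [2 theta mu] points. *)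
Lemma bad_small (x y : 'rV[R]_k) (a a' : 'rV[int]_k) :
  Kin (24 * P) x -> Kin (24 * P) y -> a \in A -> a' \in A ->
  inbox x (dil (8 * P) m) a -> inbox x (dil (8 * P) m) a' ->
  (bad (a' - a) y)%:R <= 2 * theta * mu%:R.
Proof.
move=> Kx Ky aA a'A xa xa'.
have Kv : Kin (16 * P) (2^-1 *: (x + y)).
  by apply: (@Kin_sub _ _ _ _ _ (24 * P)); [rewrite leq_mul2r orbT|exact: Kin_mid].
have Kya : Kin (16 * P) (x + y - pt a).
  apply: (@Kin_shift _ _ _ _ (16 * P) (8 * P) y); first by rewrite -mulnDl.
  move=> i; move/inboxP: xa => /(_ i); rewrite !mxE /dil natr_dil ler_norml.
  move: (x 0 i) (y 0 i) (a 0 i)%:~R (P * m i)%:R => b c d e.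
  by move=> /andP[? ?]; apply/andP; split; lra.
have := upG Kv; have := lowA Kya.
have -> : 2^-1 *: (x + y) + 2^-1 *: (x + y) = x + y.
  by rewrite -scalerDl -[RHS]scale1r; congr (_ *: _); field.
have : (count (inbox (x + y - pt a) (dil (16 * P) m)) A + bad (a' - a) y <=
  count (inbox (x + y) (dil (16 * P) m)) G)%N.
  apply: (@count_disjoint _ _ (fun b => a + b) (fun b => a' + b)) => //.
  - move=> b bA xb; rewrite AG//= -(inbox_shift _ _ a b) in xb *.
    by rewrite subrK in xb.
  - move=> b bA /andP[_ yb]; rewrite AG//=; apply/inboxP => i.
    move/inboxP: yb => /(_ i); move/inboxP: xa => /(_ i).
    rewrite !mxE /dil !natr_dil !intrD intrN.
    move: (x 0 i) (y 0 i) (a 0 i)%:~R (P * m i)%:R (b 0 i)%:~R (a' 0 i)%:~R.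
    by move=> c d e f g h /andP[? ?] /andP[? ?]; apply/andP; split; lra.
  - move=> b b' bA b'A _ /andP[/negP nA _] e; apply: nA.
    by rewrite addrA (addrC b') -e addrAC subrr add0r.
by rewrite -(ler_nat R) natrD; lra.
Qed.

(** One pair of points of [A] at difference [t] is enough, because [bad_small] spreads it to all
    interior boxes. The size bound keeps translates inside the boxes of [8 * P] cells. *)
Definition period (t : 'rV[int]_k) : Prop :=
  (forall i, `|(t 0 i)%:~R| <= 2 * (P * m i)%:R :> R) /\
  exists2 x : 'rV[R]_k, Kin (24 * P) x &
  exists2 b : 'rV[int]_k, (b \in A) && (b + t \in A) &
    inbox x (dil (8 * P) m) b && inbox x (dil (8 * P) m) (b + t).

Lemma period_bad t y : period t -> Kin (24 * P) y ->
  (bad t y)%:R <= 2 * theta * mu%:R.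
Proof.
move=> [_ [x Kx [b /andP[bA btA] /andP[xb xbt]]]] Ky.
have := bad_small Kx Ky bA btA xb xbt.
by rewrite addrAC subrr add0r.
Qed.

Lemma periodN t : period t -> period (- t).
Proof.
move=> [tP [x Kx [b /andP[bA btA] /andP[xb xbt]]]]; split.
  by move=> i; rewrite mxE intrN normrN.
by exists x => //; exists (b + t); rewrite addrK ?btA ?xbt.
Qed.

Lemma Kin_y0 c : (c <= 160)%N -> Kin (c * P) y0.
Proof. by move=> c160; apply: Kin_sub y0K; rewrite leq_mul2r c160 orbT. Qed.

Lemma period0 : period 0.
Proof.
split=> [i|]; first by rewrite mxE normr0 mulr_ge0.
exists y0; first exact: Kin_y0.
have := smallA (@Kin_y0 16 isT).
have : 0 < beta * mu%:R by rewrite mulr_gt0// (le_lt_trans _ theta_beta)// mulr_ge0.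
move=> /lt_le_trans /[apply]; rewrite ltr0n -has_count => /hasP[b bA yb].
exists b; rewrite addr0 ?bA//= andbb.
apply/inboxP => i; move/inboxP: yb => /(_ i); rewrite /dil natr_dil.
have : 0 <= (P * m i)%:R :> R by [].
by move=> ? /andP[? ?]; apply/andP; split; lra.
Qed.

(** The two shifts fail for at most [4 * theta * mu] points together, fewer than the [beta * mu]
    points of the box at [y0]. Some [b] thus has [b + s + t] in [A]: a new exact witness, with the
    same error as for [s] and [t]. *)
Lemma periodD s t : period s -> period t ->
  (forall i, `|((s + t) 0 i)%:~R| <= 2 * (P * m i)%:R :> R) -> period (s + t).
Proof.
move=> ps pt' st.
pose y := y0 - \row_i (2 * (P * m i)%:R).
have Ky : Kin (24 * P) y.
  apply: (@Kin_shift _ _ _ _ _ (2 * P) y0).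
    by rewrite -mulnDl; exact: Kin_y0.
  by move=> i; rewrite !mxE natr_dil addrAC subrr add0r normrN ger0_norm// mulr_ge0.
have inY (b u : 'rV[int]_k) : inbox y0 (dil P m) b ->
    (forall i, `|(u 0 i)%:~R| <= 2 * (P * m i)%:R :> R) ->
    inbox y (dil (8 * P) m) (b + u).
  move=> /inboxP yb uP; apply/inboxP => i; have := yb i; have := uP i.
  rewrite !mxE /dil natr_dil intrD ler_norml.
  have : 0 <= (P * m i)%:R :> R by [].
  move: (y0 0 i) (b 0 i)%:~R (u 0 i)%:~R (P * m i)%:R => c d e f.
  by move=> ? /andP[? ?] /andP[? ?]; apply/andP; split; lra.
have : has (fun b => inbox y0 (dil P m) b && (b + (s + t) \in A)) A.
  apply/negPn/negP => /hasPn nh.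
  have : (count (inbox y0 (dil P m)) A <= bad s y + bad t y)%N.
    apply: (@leq_trans (count (fun b => ((b + s)%R \notin A) &&
         inbox y (dil (8 * P) m) (b + s)%R) A +
        count (fun b => ((b + s)%R \in A) && ((b + s + t)%R \notin A) &&
         inbox y (dil (8 * P) m) (b + s + t)%R) A)).
      apply: count_or => b bA yb; have := nh b bA; rewrite yb/= => nst.
      rewrite -addrA nst !inY//; last by case: ps.
      by case: (_ \in A).
    rewrite leq_add2l.
    apply: (@count_inj _ _ (fun b => b + s)) => // [b b' _ _ _ _ /addIr//|b bA].
    by move=> /andP[/andP[-> ->] ->].
  rewrite -(ler_nat R) natrD => cnt.
  have := smallA (@Kin_y0 16 isT); have := period_bad ps Ky.
  have := period_bad pt' Ky.
  have : 4 * theta * mu%:R < beta * mu%:R by rewrite ltr_pM2r.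
  lra.
move=> /hasP[b bA /andP[yb bst]]; split=> //.
exists y => //; exists b; rewrite ?bA ?bst// inY// andbT -[b]addr0 inY//.
by move=> i; rewrite mxE normr0 mulr_ge0.
Qed.

(** * From short almost-periods to a lattice *)

Variable D0 : nat.
Hypothesis D0_gt : (2 * P)%:R ^+ k < D0.+1%:R * beta.
Hypothesis D0_le : forall i, (D0`! <= P * m i)%N.
Local Notation e i := (delta_mx 0 i : 'rV[int]_k).

Lemma axis_bound (c : int) (i j : 'I_k) : (`|c|%N <= 2 * (P * m i))%N ->
  `|((c *: e i) 0 j)%:~R| <= 2 * (P * m j)%:R :> R.
Proof.
move=> ci; rewrite !mxE eqxx/=; have [->|ji] := eqVneq j i; last first.
  by rewrite mulr0 normr0 mulr_ge0.
by rewrite mulr1 -intr_norm -abszE -natrM -pmulrn ler_nat.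
Qed.

(** The [D0 + 1] translates along the axis of the points of [A] in one box stay in a box of twice
    the side, which is too small for them to be disjoint. *)
Lemma axis_collision i : exists2 q, (0 < q <= D0)%N & period (q%:Z *: e i).
Proof.
have D0P : (D0 <= P * m i)%N by rewrite (leq_trans _ (D0_le i))// fact_geq.
pose A' := [seq a <- A | inbox y0 (dil P m) a].
pose Q := iota 0 D0.+1.
have QE q : (q \in Q) = (q <= D0)%N by rewrite mem_iota add0n ltnS.
pose L := [seq (a, q) | a <- A', q <- Q].
pose f (p : 'rV[int]_k * nat) := p.1 + p.2%:Z *: e i.
have uL : uniq L.
  by apply: allpairs_uniq; rewrite ?filter_uniq ?iota_uniq// => -[? ?] [? ?].
have boxf p : p \in L -> inbox y0 (dil (2 * P) m) (f p).
  move=> /allpairsP[[a q] /= [aA qD ->]]; rewrite /f/=.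
  move: aA; rewrite mem_filter => /andP[/inboxP ya _]; apply/inboxP => j.
  rewrite QE in qD.
  have := ya j; rewrite !mxE eqxx/= /dil natr_dil intrD.
  have := ler0n R (P * m j).
  have [->|ji] := eqVneq j i.
    have : q%:R <= (P * m i)%:R :> R by rewrite ler_nat (leq_trans qD).
    have := ler0n R q; rewrite mulr1 -[(q%:Z)%:~R]/(q%:R).
    by move=> ? ? ? /andP[? ?]; apply/andP; split; lra.
  by rewrite mulr0 addr0 => ? /andP[? ?]; apply/andP; split; lra.
have : has (fun p => has (fun p' => (p != p') && (f p == f p')) L) L.
  apply/negPn/negP => /hasPn nh.
  have fi : {in L &, injective f}.
    move=> p p' pL p'L fp; apply/eqP; have /hasPn/(_ p' p'L) := nh p pL.
    by rewrite fp eqxx andbT negbK.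
  have : (size L <= (2 * P) ^ k * \prod_i m i)%N.
    rewrite -(size_map f) -prod_dil.
    apply: leq_trans (@count_inbox_le R k (map f L) y0 _ _).
      rewrite -(size_filter (inbox _ _)).
      suff /all_filterP -> : all (inbox y0 (dil (2 * P) m)) (map f L) by [].
      by apply/allP => _ /mapP[p pL ->]; exact: boxf.
    by rewrite map_inj_in_uniq.
  have szA' : size A' = count (inbox y0 (dil P m)) A by rewrite size_filter.
  rewrite size_allpairs size_iota szA' -(ler_nat R) !natrM natrX.
  have := ler_wpM2r (ler0n R D0.+1) (smallA (@Kin_y0 16 isT)).
  have : (2 * P)%:R ^+ k * mu%:R < D0.+1%:R * beta * mu%:R by rewrite ltr_pM2r.
  by move: (_ ^+ k * _) => c; lra.
have per a a' q q' : (a, q) \in L -> (a', q') \in L -> f (a, q) = f (a', q') ->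
    (q < q')%N -> exists2 q, (0 < q <= D0)%N & period (q%:Z *: e i).
  move=> /allpairsP[[b c] /= [aA qD [-> ->]]] {a q}.
  move=> /allpairsP[[b' c'] /= [a'A q'D [-> ->]]] {a' q'}.
  rewrite /f/= => fE cc'.
  have cD : (c' - c <= D0)%N by rewrite QE in q'D; rewrite (leq_trans _ q'D)// leq_subr.
  exists (c' - c)%N; first by rewrite subn_gt0 cc'.
  split.
    move=> j; apply: axis_bound; rewrite absz_nat (leq_trans cD)//.
    by rewrite (leq_trans D0P)// leq_pmull.
  have bE : b' + (c' - c)%N%:Z *: e i = b.
    have -> : (c' - c)%N%:Z = c'%:Z - c%:Z by rewrite subzn// ltnW.
    by rewrite scalerBl addrA -fE addrK.
  exists y0; first exact: Kin_y0.
  move: aA a'A; rewrite !mem_filter => /andP[yb bA] /andP[yb' b'A].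
  have wide a : inbox y0 (dil P m) a -> inbox y0 (dil (8 * P) m) a.
    move=> /inboxP ya; apply/inboxP => j; have := ya j; rewrite /dil natr_dil.
    by have := ler0n R (P * m j); move=> ? /andP[? ?]; apply/andP; split; lra.
  by exists b'; rewrite bE ?b'A ?bA// !wide.
move=> /hasP[[a q] aL /hasP[[a' q'] a'L /andP[ne /eqP fE]]].
have [qq'|qq'|qq'] := ltngtP q q'; first exact: (per _ _ _ _ aL a'L).
  exact: (per _ _ _ _ a'L aL).
by move: ne fE; rewrite /f/= qq' => /eqP ne /addIr aa'; case: ne; rewrite aa'.
Qed.

Lemma axis_multiple i (q j : nat) : period (q%:Z *: e i) ->
  (j * q <= 2 * (P * m i))%N -> period ((j * q)%N%:Z *: e i).
Proof.
move=> pq; elim: j => [|j IH] jq.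
  by rewrite mul0n scale0r; exact: period0.
have -> : (j.+1 * q)%N%:Z *: e i = q%:Z *: e i + (j * q)%N%:Z *: e i.
  by rewrite -scalerDl mulSn PoszD.
apply: periodD => //.
  by apply: IH; rewrite (leq_trans _ jq)// leq_mul2r leqnSn orbT.
by move=> l; rewrite -scalerDl -PoszD -mulSn; exact: axis_bound.
Qed.

(** The factorial is a multiple of every possible [q], hence a modulus common to all axes. *)
Lemma axis_period i : period ((D0`!)%:Z *: e i).
Proof.
have [q /andP[q0 qD] pq] := axis_collision i.
have qf : (q %| D0`!)%N by rewrite dvdn_fact// q0.
rewrite -(divnK qf); apply: axis_multiple => //; rewrite divnK//.
by rewrite (leq_trans (D0_le i))// leq_pmull.
Qed.

(** Moving one coordinate at a time towards [t] by [D0!], each intermediate vector stays between [u]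
    and [t], so [periodD] applies at every step. The induction is on the l1 distance. *)
Lemma period_congr (u t : 'rV[int]_k) : period u ->
  (forall i, ((D0`!)%:Z %| (t 0 i - u 0 i)%R)%Z) ->
  (forall i, `|(t 0 i)%:~R| <= 2 * (P * m i)%:R :> R) -> period t.
Proof.
have [s] := ubnP (\sum_i absz (t 0%R i - u 0%R i)%R); elim: s u => // s IH u us pu tu tP.
have [->//|ntu] := eqVneq t u.
have [i tui] : exists i, t 0 i != u 0 i.
  apply/existsP; rewrite -[[exists _, _]]negbK negb_exists.
  apply: contra ntu => /forallP H; apply/eqP/rowP => i.
  by have := H i; rewrite negbK => /eqP.
have D1 : (0 < D0`!)%N by exact: fact_gt0.
pose sg : int := if u 0 i < t 0 i then 1 else -1.
pose u' := u + (sg * (D0`!)%:Z) *: e i.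
have dv : (D0`! <= absz (t 0%R i - u 0%R i)%R)%N.
  by rewrite dvdn_leq// ?absz_gt0 ?subr_eq0//; exact: tu.
have u'i : u' 0 i = u 0 i + sg * (D0`!)%:Z by rewrite !mxE !eqxx mulr1.
have u'j j : j != i -> u' 0 j = u 0 j.
  by move=> /negbTE ji; rewrite !mxE ji andbF mulr0 addr0.
have u'b : (t 0 i <= u' 0 i <= u 0 i) || (u 0 i <= u' 0 i <= t 0 i).
  rewrite u'i /sg; move: dv tui; move: (t 0 i) (u 0 i) (D0`!) => a b c.
  by case: ifP; clear; lia.
have u'P j : `|(u' 0 j)%:~R| <= 2 * (P * m j)%:R :> R.
  have [->|ji] := eqVneq j i; last by rewrite u'j//; case: pu.
  case: pu => /(_ i) uP _; move: (tP i) uP u'b; rewrite !ler_norml.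
  rewrite -!(ler_int R); move: (t 0 i)%:~R (u 0 i)%:~R (u' 0 i)%:~R => a b c.
  by move=> /andP[? ?] /andP[? ?] /orP[] /andP[? ?]; apply/andP; split; lra.
apply: (IH u').
- rewrite (leq_trans _ (us : (_ <= s)%N))// (bigD1 i)//= [ltnRHS](bigD1 i)//= -addSn.
  apply: leq_add; last by apply: leq_sum => j ji; rewrite u'j.
  rewrite u'i /sg; move: dv D1 tui; move: (t 0 i) (u 0 i) (D0`!) => a b c.
  by case: ifP; clear; lia.
- apply: periodD => //; rewrite /sg; case: ifP => _.
    by rewrite mul1r; exact: axis_period.
  by rewrite mulN1r scaleNr; apply: periodN; exact: axis_period.
- move=> j; have [->|ji] := eqVneq j i; last by rewrite u'j.
  by rewrite u'i opprD addrA; apply: rpredB; [exact: tu|exact: dvdz_mull].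
- exact: tP.
Qed.

(** Periods are short by definition; taking whole residue classes modulo [D0!] removes the size
    restriction and gives a subgroup. *)
Definition lattice (t : 'rV[int]_k) : Prop :=
  exists2 u, period u & forall i, ((D0`!)%:Z %| (t 0 i - u 0 i)%R)%Z.

Lemma lattice_period (t : 'rV[int]_k) : lattice t ->
  (forall i, `|(t 0 i)%:~R| <= 2 * (P * m i)%:R :> R) -> period t.
Proof. by move=> [u pu tu]; exact: period_congr pu tu. Qed.

Lemma period_lattice (t : 'rV[int]_k) : period t -> lattice t.
Proof. by move=> pt; exists t => // i; rewrite subrr dvdz0. Qed.

Lemma fact_bound i : (D0`!)%:R <= (P * m i)%:R :> R.
Proof. by rewrite ler_nat. Qed.

Lemma lattice_mod (t : 'rV[int]_k) : lattice t ->
  period (\row_i (t 0%R i %% (D0`!)%:Z)%Z).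
Proof.
move=> [u pu tu]; apply: (period_congr pu) => i; rewrite !mxE.
  have -> : ((t 0%R i %% (D0`!)%:Z)%Z - u 0 i)%R =
      (t 0%R i - u 0%R i)%R - (t 0%R i %/ (D0`!)%:Z)%Z * (D0`!)%:Z.
    by rewrite {2}(divz_eq (t 0 i) (D0`!)%:Z); ring.
  by apply: rpredB; [exact: tu|exact: dvdz_mull].
have D1 : (0 < D0`!)%N by exact: fact_gt0.
have z0 : (0 <= (t 0%R i %% (D0`!)%:Z)%Z)%R by rewrite modz_ge0// -lt0n.
rewrite ger0_norm ?ler0z//.
have : ((t 0%R i %% (D0`!)%:Z)%Z)%:~R < (D0`!)%:R :> R.
  by rewrite -[ltRHS]/((D0`!)%:Z%:~R) ltr_int ltz_pmod.
have := fact_bound i; have := ler0n R (P * m i); lra.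
Qed.

Lemma lattice0 : lattice 0.
Proof. exact/period_lattice/period0. Qed.

(** The representatives reduced modulo [D0!] have entries below [P * m], so their difference is
    short enough for [periodD]. *)
Lemma latticeB (s t : 'rV[int]_k) : lattice s -> lattice t -> lattice (s - t).
Proof.
move=> ls lt; have ps := lattice_mod ls; have pt' := lattice_mod lt.
exists (\row_i (s 0%R i %% (D0`!)%:Z)%Z - \row_i (t 0%R i %% (D0`!)%:Z)%Z).
  apply: periodD => //; first exact: periodN.
  move=> i; rewrite !mxE intrD intrN ler_norml.
  have D1 : (0 < D0`!)%N by exact: fact_gt0.
  have bnd (c : int) : 0 <= ((c %% (D0`!)%:Z)%Z)%:~R :> R /\
      ((c %% (D0`!)%:Z)%Z)%:~R < (D0`!)%:R :> R.
    rewrite ler0z modz_ge0 -?lt0n//; split=> //.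
    by rewrite -[ltRHS]/((D0`!)%:Z%:~R) ltr_int ltz_pmod.
  have [? ?] := bnd (s 0 i); have [? ?] := bnd (t 0 i).
  have := fact_bound i; have := ler0n R (P * m i) => ? ?.
  by apply/andP; split; lra.
move=> i; rewrite !mxE.
have -> : (s 0 i - t 0 i - ((s 0%R i %% (D0`!)%:Z)%Z - (t 0%R i %% (D0`!)%:Z)%Z))%R =
   ((s 0%R i %/ (D0`!)%:Z)%Z - (t 0%R i %/ (D0`!)%:Z)%Z) * (D0`!)%:Z.
  rewrite {1}(divz_eq (s 0 i) (D0`!)%:Z) {1}(divz_eq (t 0 i) (D0`!)%:Z).
  by ring.
exact: dvdz_mull.
Qed.

Lemma latticeN (t : 'rV[int]_k) : lattice t -> lattice (- t).
Proof. by move=> lt; rewrite -[- t]add0r; apply: latticeB lt; exact: lattice0. Qed.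

Lemma latticeD (s t : 'rV[int]_k) : lattice s -> lattice t -> lattice (s + t).
Proof. by move=> ls lt; rewrite -[t]opprK; apply: latticeB ls _; exact: latticeN. Qed.

Lemma box_witness (x : 'rV[R]_k) : Kin (16 * P) x ->
  exists2 a, a \in A & inbox x (dil P m) a.
Proof.
move=> Kx; have := smallA Kx.
have : 0 < beta * mu%:R by rewrite mulr_gt0// (le_lt_trans _ theta_beta)// mulr_ge0.
by move=> /lt_le_trans /[apply]; rewrite ltr0n -has_count => /hasP[b bA yb]; exists b.
Qed.

(* Two points in far apart boxes are compared through the midpoint. *)
Lemma boxes_congruent j (x y : 'rV[R]_k) (a b : 'rV[int]_k) :
  Kin (32 * P) x -> Kin (32 * P) y -> a \in A -> b \in A ->
  inbox x (dil P m) a -> inbox y (dil P m) b ->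
  (forall i, `|x 0 i - y 0 i| <= 2 ^+ j * (P * m i)%:R) -> lattice (a - b).
Proof.
elim: j x y a b => [|j IH] x y a b Kx Ky aA bA xa yb xy.
  apply: period_lattice; split=> [i|].
    move: (xy i); move/inboxP: xa => /(_ i); move/inboxP: yb => /(_ i).
    rewrite !mxE /dil expr0 mul1r intrD intrN !ler_norml.
    move: (x 0 i) (y 0 i) (a 0 i)%:~R (b 0 i)%:~R (P * m i)%:R => c d e f g.
    by move=> /andP[? ?] /andP[? ?] /andP[? ?]; apply/andP; split; lra.
  exists (x - \row_i (P * m i)%:R).
    apply: (@Kin_shift _ _ _ _ _ (8 * P) x).
      by rewrite -mulnDl.
    move=> i; rewrite !mxE natr_dil addrAC subrr add0r normrN ger0_norm//.
    by have := ler0n R (P * m i); lra.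
  exists b; rewrite subrKC ?bA ?aA//; apply/andP; split; apply/inboxP => i.
    move: (xy i); move/inboxP: yb => /(_ i); have := ler0n R (P * m i).
    rewrite !mxE /dil natr_dil expr0 mul1r ler_norml.
    move: (x 0 i) (y 0 i) (b 0 i)%:~R (P * m i)%:R => c d e f.
    by move=> ? /andP[? ?] /andP[? ?]; apply/andP; split; lra.
  move/inboxP: xa => /(_ i); have := ler0n R (P * m i).
  rewrite !mxE /dil natr_dil; move: (x 0 i) (a 0 i)%:~R (P * m i)%:R => c d e.
  by move=> ? /andP[? ?]; apply/andP; split; lra.
have Kv : Kin (32 * P) (2^-1 *: (x + y)) by exact: Kin_mid.
have Kv' : Kin (16 * P) (2^-1 *: (x + y)).
  by apply: Kin_sub Kv; rewrite leq_mul2r orbT.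
have [c cA vc] := box_witness Kv'.
have -> : a - b = (a - c) + (c - b) by rewrite addrA subrK.
apply: latticeD.
  apply: (IH x (2^-1 *: (x + y))) => // i; have := xy i; rewrite !mxE exprS !ler_norml.
  move: (x 0 i) (y 0 i) (2 ^+ j) (P * m i)%:R => d e f g.
  by move=> /andP[? ?]; apply/andP; split; lra.
apply: (IH (2^-1 *: (x + y)) y) => // i; have := xy i; rewrite !mxE exprS !ler_norml.
move: (x 0 i) (y 0 i) (2 ^+ j) (P * m i)%:R => d e f g.
by move=> /andP[? ?]; apply/andP; split; lra.
Qed.

(** * All of [A] lies in one coset, which it nearly fills *)

Hypothesis P0 : (0 < P)%N.

Lemma inbox_self (a : 'rV[int]_k) : inbox (pt a) (dil P m) a.
Proof.
by apply/inboxP => i; rewrite !mxE lexx/= ltrDl ltr0n muln_gt0 P0 m0.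
Qed.

Variable j0 : nat.
Hypothesis boxK : forall x y : 'rV[R]_k, K x -> K y ->
  forall i, `|x 0 i - y 0 i| <= 2 ^+ j0 * (P * m i)%:R.

Lemma interior_congruent (a b : 'rV[int]_k) : a \in A -> b \in A ->
  Kin (32 * P) (pt a) -> Kin (32 * P) (pt b) -> lattice (a - b).
Proof.
move=> aA bA Ka Kb; apply: (@boxes_congruent j0 (pt a) (pt b)) => //;
  try exact: inbox_self.
by apply: boxK; [exact: Kin_mem Ka|exact: Kin_mem Kb].
Qed.

Hypothesis T_gt : 3 * theta < T.

Lemma Kin_inbox Q c (x : 'rV[R]_k) (a : 'rV[int]_k) : Kin ((Q + c) * P) x ->
  inbox x (dil (c * P) m) a -> Kin (Q * P) (pt a).
Proof.
move=> Kx xa; apply: (@Kin_shift _ _ _ _ _ (c * P) x); first by rewrite -mulnDl.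
move=> i; move/inboxP: xa => /(_ i); rewrite !mxE /dil ler_norml.
move: (x 0 i) (a 0 i)%:~R (c * P * m i)%:R => d e f.
by move=> /andP[? ?]; apply/andP; split; lra.
Qed.

(* The sums [a + A] and [b + A] must meet near [pt a + y0]. *)
Lemma all_congruent (a b : 'rV[int]_k) : a \in A -> b \in A -> lattice (a - b).
Proof.
suff [c cA H] : exists2 c, c \in A & {in A, forall a : 'rV[int]_k, lattice (a - c)}.
  move=> aA bA; have -> : a - b = (a - c) - (b - c).
    by rewrite opprB addrA subrK.
  by apply: latticeB; apply: H.
have [c cA yc] := box_witness (@Kin_y0 16 isT).
have Kc : Kin (32 * P) (pt c).
  by apply: (@Kin_inbox 32 1 y0); rewrite ?mul1n//; exact: (@Kin_y0 33).
exists c => // {}a aA.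
(* The point [a] may lie on the boundary of the hull, but its midpoint with the deep point [y0] is
   half as deep as [y0]. *)
pose v := 2^-1 *: (pt a + y0).
have Kv : Kin (80 * P) v.
  by apply: Kin_half; [exact: convK|exact: AK|rewrite mulnA].
have Kv' q : (q <= 80)%N -> Kin (q * P) v.
  by move=> q80; apply: Kin_sub Kv; rewrite leq_mul2r q80 orbT.
have [{}b bA vb] := box_witness (Kv' 16%N isT).
have Kb : Kin (32 * P) (pt b).
  by apply: (@Kin_inbox 32 1 v); rewrite ?mul1n//; exact: Kv'.
have vv : v + v = pt a + y0.
  by rewrite /v -scalerDl -[RHS]scale1r; congr (_ *: _); field.
have vbi i := (elimT (inboxP _ _ _) vb) i.
have Kvb q : (q <= 79)%N -> Kin (q * P) (v + v - pt b).
  move=> q79; apply: (@Kin_shift _ _ _ _ _ (1 * P) v).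
    by rewrite -mulnDl; apply: Kv'; rewrite addn1.
  move=> i; move: (vbi i); rewrite !mxE /dil mul1n ler_norml.
  move: (2^-1 * _) (b 0 i)%:~R (P * m i)%:R => d e f.
  by move=> /andP[? ?]; apply/andP; split; lra.
(* Both translates put at least [(T - theta) * mu] points in a box where [G] has at most
   [(T + theta) * mu]; as [3 * theta < T], they meet, and [a - c] becomes a sum of differences of
   interior points. *)
have : has (fun g => inbox y0 (dil (16 * P) m) g && has (fun g' =>
    inbox (v + v - pt b) (dil (16 * P) m) g' && (a + g == b + g')) A) A.
  apply/negPn/negP => /hasPn nh.
  have : (count (inbox y0 (dil (16 * P) m)) A +
      count (inbox (v + v - pt b) (dil (16 * P) m)) A <=
      count (inbox (v + v) (dil (16 * P) m)) G)%N.
    apply: (@count_disjoint _ _ (fun g => a + g) (fun g => b + g)) => //.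
        - by move=> g gA yg; rewrite AG//= vv addrC inbox_shift.
    - by move=> g gA; rewrite AG//= -(inbox_shift _ _ b g) subrK.
    - move=> g g' gA g'A yg vg' gg'; have := nh g gA; rewrite yg/= => /hasPn.
      by move=> /(_ g' g'A); rewrite vg' gg' eqxx.
  rewrite -(ler_nat R) natrD.
  have := lowA (@Kin_y0 16 isT); have := lowA (Kvb 16%N isT).
  have := upG (Kv' 16%N isT).
  have : 3 * theta * mu%:R < T * mu%:R by rewrite ltr_pM2r.
  lra.
move=> /hasP[g gA /andP[yg /hasP[g' g'A /andP[vg' /eqP gg']]]].
have Kg : Kin (32 * P) (pt g) by apply: (Kin_inbox _ yg); exact: Kin_y0.
have Kg' : Kin (32 * P) (pt g') by apply: (Kin_inbox _ vg'); exact: Kvb.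
have -> : a - c = (g' - g) + (b - c).
  by rewrite addrA; congr (_ - _); rewrite addrAC (addrC g') -gg' addrK.
by apply: latticeD; apply: interior_congruent.
Qed.

(** Count the pairs of a point of [A] in the box and a point of [F]. Their difference is a short
    lattice vector, hence a period, and a given period accounts for at most [2 * theta * mu] pairs,
    since it leads out of [A]. At most (3P)^k [mu] differences are possible. *)
Lemma box_missing (y : 'rV[R]_k) (F : seq 'rV[int]_k) :
  Kin (32 * P) y -> uniq F ->
  {in F, forall x : 'rV[int]_k, [/\ x \notin A, inbox y (dil P m) x &
     {in A, forall a : 'rV[int]_k, lattice (x - a)}]} ->
  (size F)%:R * beta <= (3 * P)%:R ^+ k * (2 * theta) * mu%:R.
Proof.
move=> Ky uF HF.
pose TB := zbox (- \row_i (P * m i)%:Z) (fun i => 2 * (P * m i) + 1)%N.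
have szTB : (size TB)%:R <= (3 * P)%:R ^+ k * mu%:R :> R.
  rewrite -natrX -natrM ler_nat size_zbox -prod_dil; apply: leq_prod => i _.
  have : (0 < P * m i)%N by rewrite muln_gt0 P0 m0.
  by rewrite /dil -mulnA; move: (P * m i)%N => c; clear; lia.
have Kin16 : Kin (16 * P) y by apply: Kin_sub Ky; rewrite leq_mul2r orbT.
have Kin24 : Kin (24 * P) y by apply: Kin_sub Ky; rewrite leq_mul2r orbT.
pose hit t a := inbox y (dil P m) a && ((a + t)%R \in F).
have hit_le t : (count (hit t) A)%:R <= 2 * theta * mu%:R.
  have [/hasP[a aA /andP[ya atF]]|] := boolP (has (hit t) A); last first.
    by rewrite has_count -leqNgt leqn0 => /eqP ->; rewrite !mulr_ge0.
  have [atA yat /(_ a aA)] := HF _ atF; rewrite addrAC subrr add0r => lt.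
  have pt' : period t.
    apply: lattice_period => // i.
    move/inboxP: ya => /(_ i); move/inboxP: yat => /(_ i).
    rewrite !mxE /dil intrD ler_norml.
    move: (y 0 i) (a 0 i)%:~R (t 0 i)%:~R (P * m i)%:R => c d e' f.
    by move=> /andP[? ?] /andP[? ?]; apply/andP; split; lra.
  apply: le_trans (period_bad pt' Kin24); rewrite ler_nat; apply: count_imp.
  move=> b bA /andP[yb btF]; have [-> ybt _] /= := HF _ btF.
  apply/inboxP => i; move/inboxP: ybt => /(_ i); have := ler0n R (P * m i).
  by rewrite /dil natr_dil => ? /andP[? ?]; apply/andP; split; lra.
have cnt : (count (inbox y (dil P m)) A * size F <= \sum_(t <- TB) count (hit t) A)%N.
  rewrite sumn_count_exchange -sum1_count big_distrl/= big_mkcond/=.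
  rewrite big_seq [leqRHS]big_seq; apply: leq_sum => a aA; case: ifP => // ya.
  rewrite mul1n -(count_predT F).
  apply: (@count_inj _ _ (fun x => x - a)) => // [x x' _ _ _ _ /addIr//|x xF _].
  rewrite /hit ya/= subrKC xF andbT; apply/mem_zboxP => i.
  have [_ yx _] := HF _ xF.
  move/inboxP: ya => /(_ i); move/inboxP: yx => /(_ i); rewrite !mxE /dil.
  rewrite -[(P * m i)%:R]/((P * m i)%:Z%:~R).
  move: (P * m i)%N => c /andP[h1 h2] /andP[h3 h4].
  have : (x 0 i)%:~R < (a 0 i)%:~R + c%:Z%:~R :> R by lra.
  have : (a 0 i)%:~R < (x 0 i)%:~R + c%:Z%:~R :> R by lra.
  rewrite -!intrD !ltr_int; move: (x 0 i) (a 0 i) => d f.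
  by clear; lia.
have : beta * mu%:R * (size F)%:R <= (size TB)%:R * (2 * theta * mu%:R).
  apply: (@le_trans _ _ (count (inbox y (dil P m)) A * size F)%:R).
    by rewrite natrM ler_wpM2r// smallA.
  apply: (@le_trans _ _ (\sum_(t <- TB) count (hit t) A)%:R).
    by rewrite ler_nat.
  rewrite natr_sum; apply: (@le_trans _ _ (\sum_(t <- TB) 2 * theta * mu%:R)).
    by apply: ler_sum => t _; exact: hit_le.
  by rewrite big_const_seq count_predT iter_addr_0 [leRHS]mulr_natl.
move=> H; rewrite -(ler_pM2r mu0).
have : (size TB)%:R * (2 * theta * mu%:R) <=
    (3 * P)%:R ^+ k * mu%:R * (2 * theta * mu%:R).
  by rewrite ler_wpM2r// !mulr_ge0.
by move: (_ ^+ k) => c; lra.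
Qed.

End PeriodLattice.

(** * Points near the boundary of the hull *)

Section Boundary.
Variables (R : archiRealFieldType) (k : nat).
Local Notation pt := (map_mx intr : 'rV[int]_k -> 'rV[R]_k).
Variable K : pred 'rV[R]_k.
Hypothesis convK : forall x y (t : R), 0 <= t <= 1 -> K x -> K y ->
  K (t *: x + (1 - t) *: y).
Variables (n m : 'I_k -> nat) (M : nat).
Hypothesis M0 : (0 < M)%N.
Hypothesis mn : forall i, (M * m i <= n i)%N.
Hypothesis Kn : forall x, K x -> forall i, 0 <= x 0 i < (n i)%:R.

(** Boolean form of [Kin], involving only finitely many translations. *)
Definition cornerK Q (x : 'rV[R]_k) : bool :=
  [forall s : {ffun 'I_k -> bool}, K (x + \row_i ((-1) ^+ s i * (Q * m i)%:R))].

(** A point near the boundary leaves [K] by one of 2^k diagonal translations, and a translation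
    drives no more points out of a convex set than out of a box containing it. *)
Lemma count_boundary (F : seq 'rV[int]_k) Q : uniq F ->
  {in F, forall x : 'rV[int]_k, K (pt x)} ->
  (count (fun x => ~~ cornerK Q (pt x)) F)%:R <=
  2 ^+ k * (k%:R * (Q%:R / M%:R) * (\prod_i n i)%:R) :> R.
Proof.
move=> uF FK.
pose u (s : {ffun 'I_k -> bool}) : 'rV[int]_k := \row_i ((-1) ^+ s i * (Q * m i)%:Z).
have ptD x s : pt (x + u s) = pt x + \row_i ((-1) ^+ s i * (Q * m i)%:R).
  by apply/rowP => i; rewrite !mxE intrD intrM intr_sign.
apply: (@le_trans _ _ ((\sum_(s : {ffun 'I_k -> bool})
    count (fun x => ~~ K (pt (x + u s)%R)) F)%N%:R : R)).
  rewrite ler_nat; apply: count_ex => x _; rewrite negb_forall => /existsP[s].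
  by rewrite -ptD; exists s.
have -> : 2 ^+ k * (k%:R * (Q%:R / M%:R) * (\prod_i n i)%:R) =
    \sum_(s : {ffun 'I_k -> bool}) k%:R * (Q%:R / M%:R) * (\prod_i n i)%:R :> R.
  by rewrite sumr_const card_ffun card_bool card_ord -[RHS]mulr_natl natrX.
rewrite natr_sum; apply: ler_sum => s _.
have Kz x : K (pt x) -> x \in zbox 0 n.
  move=> /Kn Kx; apply/mem_zboxP => i; have := Kx i.
  by rewrite !mxE add0r ler0z -[(n i)%:R]/((n i)%:Z%:~R) ltr_int.
apply: (@le_trans _ _ (count (fun x => (x + u s)%R \notin zbox 0 n) (zbox 0 n))%:R).
  rewrite ler_nat; apply: (@count_convex_shift_nat _ _ _ _ _ (fun x => K (pt x))) => //.
  - by move=> x xF; apply/Kz/FK.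
  - move=> x t Kx Kxt.
    have t0 : 0 < t.+1%:R :> R by rewrite ltr0n.
    have -> : pt (x + u s) =
        t.+1%:R^-1 *: pt (x + u s *+ t.+1) + (1 - t.+1%:R^-1) *: pt x.
      apply/rowP => i; rewrite !mxE mulmxnE !mxE !intrD.
      set c := (-1) ^+ s i * _.
      have -> : (c *+ t.+1)%:~R = c%:~R * t.+1%:R :> R by rewrite rmorphMn/= mulr_natr.
      by move: (t.+1%:R) t0 => d d0; field; rewrite lt0r_neq0.
    apply: convK => //; rewrite invr_ge0 ltW//= invf_le1//.
    by rewrite -natr1 lerDr.
apply: count_box_shift => i.
rewrite mxE abszM abszX mulnC absz_nat.
have -> : (`|(-1)%Z| ^ s i = 1)%N by rewrite exp1n.
rewrite muln1 mulrAC ler_pdivlMr ?ltr0n// -!natrM ler_nat -mulnA leq_mul2l.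
by rewrite (mulnC (m i)) mn orbT.
Qed.

Lemma cornerK_Kin Q x : cornerK Q x -> Kin m K Q x.
Proof. by move=> /forallP Kx; apply: Kin_corners. Qed.

End Boundary.

(** With s = 2 t, one factor 2^t absorbs the linear term and the other the constant. *)
Lemma exp_dominates (R : archiRealFieldType) (C : R) (N : nat) :
  exists2 s, (N <= s)%N & C * (3 * s + 1)%:R <= (2 ^ s)%:R.
Proof.
have [c c0 Cc] := nat_above (7 * C).
pose t := (N + c)%N; exists (t + t)%N; first by rewrite /t; lia.
have tt : (t < 2 ^ t)%N by exact: ltn_expl.
have h1 : (3 * (t + t) + 1 <= 7 * 2 ^ t)%N by lia.
have h2 : (c <= 2 ^ t)%N by rewrite (leq_trans _ (ltnW tt))// /t leq_addl.
apply: (@le_trans _ _ (c%:R / 7 * (3 * (t + t) + 1)%:R)).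
  by rewrite ler_wpM2r// ler_pdivlMr// mulrC.
apply: (@le_trans _ _ (c%:R / 7 * (7 * 2 ^ t)%:R)).
  by rewrite ler_wpM2l ?ler_nat// divr_ge0.
rewrite natrM mulrA divfK ?pnatr_eq0// -natrM ler_nat expnD leq_mul//.
Qed.

(** Half of [sigma] pays for [tau] over the [J + 1] steps, the other half for the shells, whose
    relative volume is of order [D / Q]. *)
Lemma rho_small (R : archiRealFieldType) (k J D P Q : nat) (tau sigma : R) :
  (0 < D)%N -> (2 * D <= P)%N -> (P <= Q)%N -> 0 <= tau ->
  4 * J.+1%:R * tau <= sigma ->
  16 * k%:R * 4 ^+ k * J.+1%:R * D%:R <= sigma * P%:R ->
  rho k J D tau Q <= sigma * Q%:R ^+ k.
Proof.
move=> D0 DP PQ tau0 htau hD.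
have Q0 : 0 < Q%:R :> R by rewrite ltr0n; lia.
have Qk : 1 <= Q%:R ^+ k :> R by rewrite exprn_ege1// ler1n; lia.
pose z : R := 2 * D%:R / Q%:R.
have z0 : 0 <= z by rewrite divr_ge0// mulr_ge0.
have z1 : 1 + z <= 2.
  have : z <= 1 by rewrite ler_pdivrMr// mul1r -natrM ler_nat; lia.
  lra.
have De : (Q + 2 * D)%:R ^+ k - Q%:R ^+ k = Q%:R ^+ k * ((1 + z) ^+ k - 1 ^+ k) :> R.
  rewrite mulrBr -!exprMn mulr1; congr (_ ^+ k - _).
  by rewrite mulrDr mulr1 /z mulrC divfK ?lt0r_neq0// natrD natrM.
have dz : (1 + z) ^+ k - 1 ^+ k <= k%:R * z * 2 ^+ k.
  by apply: exprD_sub_le => //; rewrite ler1n.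
have K1 : 1 <= 2 ^+ k :> R by rewrite exprn_ege1// ler1n.
have hz : 4 * J.+1%:R * 2 ^+ k * (k%:R * z * 2 ^+ k) <= sigma / 2.
  have -> : 4 * J.+1%:R * 2 ^+ k * (k%:R * z * 2 ^+ k) =
      (8 * k%:R * 4 ^+ k * J.+1%:R * D%:R) / Q%:R.
    have -> : 4 ^+ k = 2 ^+ k * 2 ^+ k :> R by rewrite -exprMn -natrM.
    by rewrite /z; field; rewrite lt0r_neq0.
  rewrite ler_pdivrMr//.
  have sg0 : 0 <= sigma by apply: le_trans htau; rewrite !mulr_ge0.
  have : sigma * P%:R <= sigma * Q%:R by rewrite ler_wpM2l// ler_nat.
  lra.
have d2 : (Q + 2)%:R ^+ k - Q%:R ^+ k <= (Q + 2 * D)%:R ^+ k - Q%:R ^+ k :> R.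
  by rewrite lerD2r lerXn2r ?nnegrE// ler_nat leq_add2l leq_pmulr.
have J1 : 1 <= J.+1%:R :> R by rewrite ler1n.
rewrite /rho /err; move: d2; rewrite De.
set d := _ - 1 ^+ k in dz *; set q := Q%:R ^+ k in Qk *; set K := 2 ^+ k in K1 *.
move=> d2.
have d0 : 0 <= d.
  by rewrite /d expr1n subr_ge0 exprn_ege1// lerDl.
have JK : 1 <= J.+1%:R * K by exact: mulr_ege1.
have hd : 4 * J.+1%:R * K * d <= sigma / 2.
  by apply: le_trans hz; rewrite ler_wpM2l// !mulr_ge0// (le_trans _ K1).
have e1 : q * d <= J.+1%:R * K * (q * d).
  by rewrite ler_peMl// mulr_ge0// (le_trans _ Qk).
have e2 : 4 * J.+1%:R * K * (q * d) <= sigma / 2 * q.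
  have -> : 4 * J.+1%:R * K * (q * d) = 4 * J.+1%:R * K * d * q by ring.
  by rewrite ler_wpM2r// (le_trans _ Qk).
have e3 : 2 * J.+1%:R * tau <= sigma / 2 * q.
  have : 0 <= sigma / 2 by apply: le_trans hd; rewrite !mulr_ge0// (le_trans _ K1).
  by move=> /ler_peMr /(_ Qk); lra.
have e4 : 0 <= J.+1%:R * K * (q * d).
  by rewrite !mulr_ge0// (le_trans _ K1, le_trans _ Qk).
lra.
Qed.

(** * Stability in a box *)

Section BoxCore.
Variables (R : archiRealFieldType) (k : nat).
Hypothesis k0 : (0 < k)%N.
Local Notation pt := (map_mx intr : 'rV[int]_k -> 'rV[R]_k).

(** Membership in the affine lattice spanned by [A], stated through all subtraction-closed
    predicates so that [lattice] can be substituted for [L]. *)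
Definition congruent_to (A : seq 'rV[int]_k) (x : 'rV[int]_k) : Prop :=
  forall L : 'rV[int]_k -> Prop, (forall s t, L s -> L t -> L (s - t)) ->
  {in A &, forall a b : 'rV[int]_k, L (a - b)} ->
  {in A, forall a : 'rV[int]_k, L (x - a)}.

Variables (eps eta sigma tau : R) (r J j D P D0 : nat).
Variables b w : R.
Hypotheses (bE : b = eps / (2 * 2 ^+ k)) (wE : w = 2 * 2 ^+ k * 8 ^+ k).
Hypotheses (eps0 : 0 < eps) (eta0 : 0 < eta) (sg0 : 0 < sigma) (tau0 : 0 < tau).
Hypothesis rP1 : 2 ^+ k * (k%:R * (21 / 2 ^+ r)) < eps.
Hypothesis rP2 : 2 ^+ k * (k%:R * (5 / 2 ^+ r)) <= eta * eps / 2.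
Hypothesis sgP1 : 4 * w * sigma < b.
Hypothesis sgP2 : 6 ^+ k * 2 * w * sigma <= eta * eps / 2 * b.
Hypothesis tau_sg : tau <= sigma.
Hypothesis tau_eps : 2 * tau < eps.
Hypothesis MP : (2 ^ J = 8 * 2 ^ r * P)%N.
Hypotheses (PE : P = (2 ^ j)%N) (jJ : (j <= J.+1)%N).
Hypothesis rho8 : rho k J D tau (8 * P) <= sigma * (8 * P)%:R ^+ k.
Hypothesis rho1 : rho k J D tau P <= sigma * P%:R ^+ k.
Hypotheses (Dsq : (24 * k <= D ^ 2)%N) (D6 : (1536 * k ^ 3 * (2 ^ J) ^ 4 <= D ^ 6)%N).
Hypothesis D0P : 2 ^+ k / b <= D0%:R.

Variables (n m : 'I_k -> nat) (A G : seq 'rV[int]_k).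
Hypothesis uA : uniq A.
Hypothesis AG : {in A &, forall a b : 'rV[int]_k, a + b \in G}.
Hypotheses (An : {subset A <= zbox 0 n}) (A0 : A != [::]).
Hypothesis epsA : eps * (\prod_i n i)%:R <= (size A)%:R.
Hypothesis mD : forall i, (D0`! <= m i)%N.
Hypothesis mn : forall i, (2 ^ J * m i <= n i)%N.
Hypothesis nm : forall i, (n i <= 2 * 2 ^ J * m i)%N.
Local Notation mu := (\prod_i m i)%N.
Hypothesis HG : forall (x : 'rV[R]_k) Q, (Q <= 2 * 2 ^ J)%N ->
    (count (inbox (x + x) (dil (2 * Q) m)) G)%:R <=
    2 ^+ k * (count (inbox x (dil Q m)) A)%:R + tau * mu%:R.
Variable K : pred 'rV[R]_k.
Hypothesis convK : forall x y (t : R), 0 <= t <= 1 -> K x -> K y ->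
  K (t *: x + (1 - t) *: y).
Hypothesis AK : {in A, forall a : 'rV[int]_k, K (pt a)}.
Hypothesis hullK : forall x, K x -> forall c : 'rV[R]_k,
     exists2 b : 'rV[int]_k, b \in A & \sum_i c 0 i * ((b 0 i)%:~R - x 0 i) <= 0.
Hypothesis Kn : forall x, K x -> forall i, 0 <= x 0 i < (n i)%:R.

(** Points of [F] near the boundary of the hull, and those in interior cells, each contribute at
    most half of the allowed number. *)
Lemma box_core (F : seq 'rV[int]_k) : uniq F ->
  {in F, forall x : 'rV[int]_k, [/\ K (pt x), x \notin A & congruent_to A x]} ->
  (size F)%:R <= eta * (size A)%:R.
Proof.
move=> uF HF; have tsg := tau_sg.
have K0 : 0 < 2 ^+ k :> R by rewrite exprn_gt0.
have K1 : 1 <= 2 ^+ k :> R by rewrite exprn_ege1// ler1n.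
have b0 : 0 < b by rewrite bE divr_gt0// mulr_gt0.
have w1 : 1 <= w.
  by rewrite wE; apply: mulr_ege1; [apply: mulr_ege1|rewrite exprn_ege1//]; rewrite ?ler1n.
have sgb : 2 * sigma <= b.
  have h : sigma <= w * sigma by rewrite ler_peMl// ltW.
  have := sg0; have := sgP1; lra.
have M0 : (0 < 2 ^ J)%N by rewrite expn_gt0.
have P0 : (0 < P)%N by rewrite PE expn_gt0.
have m0 i : (0 < m i)%N by apply: leq_trans (mD i); exact: fact_gt0.
have muN : (2 ^ J)%:R ^+ k * mu%:R <= (\prod_i n i)%:R :> R.
  by rewrite -natrX -natrM -prod_dil ler_nat; apply: leq_prod => i _; exact: mn.
have mu0 : (0 < mu)%N by rewrite prodn_gt0.
have mu0' : 0 < mu%:R :> R by rewrite ltr0n.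
have N0 : 0 < (\prod_i n i)%:R :> R.
  by apply: lt_le_trans muN; rewrite mulr_gt0// exprn_gt0// ltr0n.
have epsA' : eps * (2 ^ J)%:R ^+ k * mu%:R <= (size A)%:R.
  by apply: le_trans epsA; rewrite -mulrA ler_pM2l.
have nearK (x : 'rV[R]_k) : K x -> exists2 w : 'rV[int]_k, w \in A &
    forall i, `|(w 0 i)%:~R - x 0 i| <= (D * m i)%:R.
  move=> Kx; apply: (@hull_near R k A G m J tau k0 m0 uA AG (ltW tau0) HG
    n eps An nm epsA' tau_eps mu0) => //.
  exact: hullK.
have homA := @homothety R k A G m J tau uA AG HG.
have boxK (x y : 'rV[R]_k) : K x -> K y -> forall i, `|x 0 i - y 0 i| <= (2 * 2 ^ J * m i)%:R.
  move=> /Kn xn /Kn yn i; have /andP[x1 x2] := xn i; have /andP[y1 y2] := yn i.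
  have : (n i)%:R <= (2 * 2 ^ J * m i)%:R :> R by rewrite ler_nat.
  apply: le_trans; rewrite ler_norml; apply/andP; split.
    by rewrite lerBrDr addrC; apply: le_trans x1; rewrite subr_le0 ltW.
  by rewrite lerBlDr (le_trans (ltW x2))// lerDl.
have P8M : (8 * P <= 2 * 2 ^ J)%N.
  have -> : (2 * 2 ^ J = 2 * 2 ^ r * (8 * P))%N.
    by rewrite MP; move: (2 ^ r)%N P => q P'; clear; lia.
  by rewrite leq_pmull// -expnS expn_gt0.
have PM : (P <= 2 * 2 ^ J)%N by rewrite (leq_trans _ P8M)// leq_pmull.
have qM q : (q * (8 * P))%N%:R / (2 ^ J)%:R = q%:R / 2 ^+ r :> R.
  have P0' : P%:R != 0 :> R by rewrite pnatr_eq0 -lt0n.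
  have r0' : 2 ^+ r != 0 :> R by rewrite expf_neq0 ?pnatr_eq0.
  by rewrite MP !natrM natrX; field; rewrite P0' r0'.
(* By [rP1] the boundary layer holds fewer points than [A]. The depth [168 * P] covers the [160 * P]
   required at [y0]. *)
have [a0 a0A a0K] : exists2 a, a \in A & cornerK K m (21 * (8 * P)) (pt a).
  apply/hasP/negPn/negP => /hasPn nh.
  have := count_boundary convK M0 mn Kn (21 * (8 * P)) uA AK.
  have -> : count (fun x => ~~ cornerK K m (21 * (8 * P)) (pt x)) A = size A.
    by apply/eqP; rewrite -all_count; apply/allP => x /nh.
  apply/negP; rewrite -ltNge qM; apply: lt_le_trans epsA.
  by rewrite !mulrA ltr_pM2r// -!mulrA.
have {}a0K : Kin m K (168 * P) (pt a0).
  by rewrite (_ : 168 = 21 * 8)%N// -mulnA; exact: cornerK_Kin.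
have [z za zN] := dense_box k0 uA AG (ltW tau0) HG An nm epsA' a0A jJ.
rewrite -PE in za zN.
have Kz : Kin m K (2 * P) z.
  apply: (@Kin_shift _ _ _ _ _ (1 * P) (pt a0)).
    by rewrite -mulnDl; apply: Kin_sub a0K; rewrite leq_mul2r orbT.
  move=> i; move/inboxP: za => /(_ i); rewrite !mxE mul1n /dil ler_norml.
  move: (z 0 i) (a0 0 i)%:~R (P * m i)%:R => c d e.
  by move=> /andP[? ?]; apply/andP; split; lra.
have constK := density_const uA (ltW tau0) homA convK nearK boxK.
pose y0 := pt a0.
have y0K : Kin m K (160 * P) y0 by apply: Kin_sub a0K; rewrite leq_mul2r orbT.
have y0K16 : Kin m K (16 * P) y0 by apply: Kin_sub a0K; rewrite leq_mul2r orbT.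
(* With this value, [subbox_upper] bounds [A] from below in a box of [16 * P] cells and [HG] bounds
   [G] from above in the double of one of [8 * P] cells. *)
have [T TE] : exists T : R,
    T * mu%:R = 2 ^+ k * (count (inbox y0 (dil (8 * P) m)) A)%:R.
  exists (2 ^+ k * (count (inbox y0 (dil (8 * P) m)) A)%:R / mu%:R).
  by rewrite divfK// lt0r_neq0.
have [theta thE] : exists t, t = 2 * 2 ^+ k * rho k J D tau (8 * P) by eexists.
(* [dense_box] provides density [2 * b] up to [tau]; half of it is spent on the errors. *)
have [beta betaE] : exists t, t = b * P%:R ^+ k by eexists.
have errP Q : 0 <= err k D tau Q by exact/err_ge0/ltW.
have err_rho Q : tau <= err k D tau Q <= rho k J D tau Q.
  rewrite /rho {1}/err lerDl mulr_ge0 ?exprn_ge0 ?shell_ge0//=.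
  have : err k D tau Q <= J.+1%:R * err k D tau Q by rewrite ler_peMl// ler1n.
  have : 0 <= (Q + 2)%:R ^+ k - Q%:R ^+ k :> R by exact: shell_ge0.
  have := errP Q; lra.
have PK : 1 <= P%:R ^+ k :> R by rewrite exprn_ege1// ler1n.
have rho0 Q : 0 <= rho k J D tau Q.
  by have /andP[t1 t2] := err_rho Q; apply: le_trans t2; exact: errP.
have lowA (x : 'rV[R]_k) : Kin m K (16 * P) x ->
    (T - theta) * mu%:R <= (count (inbox x (dil (16 * P) m)) A)%:R.
  have e16 : (2 * (8 * P) = 16 * P)%N by rewrite mulnA.
  rewrite -e16 in y0K16 * => Kx.
  have := constK y0 x (8 * P)%N y0K16 Kx P8M.
  have := subbox_upper uA (ltW tau0) homA nearK Kx P8M.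
  rewrite mulrBl TE thE; have /andP[_ er] := err_rho (8 * P)%N.
  have := ler_wpM2r (ler0n R mu) er.
  move: (count _ _)%:R (count _ _)%:R (count _ _)%:R => c1 c2 c3 h1 h2 h3.
  have := ler_wpM2l (ltW K0) h1; have := ler_wpM2l (ltW K0) h3.
  rewrite mulrDr !mulrA; lra.
have upG (x : 'rV[R]_k) : Kin m K (16 * P) x ->
    (count (inbox (x + x) (dil (16 * P) m)) G)%:R <= (T + theta) * mu%:R.
  have e16 : (2 * (8 * P) = 16 * P)%N by rewrite mulnA.
  rewrite -e16 in y0K16 * => Kx; rewrite mulrDl TE thE.
  have := constK x y0 (8 * P)%N Kx y0K16 P8M.
  have := HG x P8M.
  have /andP[te er] := err_rho (8 * P)%N.
  have := ler_wpM2r (ler0n R mu) (le_trans te er).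
  move: (count _ _)%:R (count _ _)%:R (count _ _)%:R => c1 c2 c3 h1 h2 h3.
  have := ler_wpM2l (ltW K0) h3.
  have r0 : 0 <= rho k J D tau (8 * P) * mu%:R by rewrite mulr_ge0.
  have := ler_wpM2r r0 K1.
  rewrite mulrDr !mulrA; lra.
have smallA (x : 'rV[R]_k) : Kin m K (16 * P) x ->
    beta * mu%:R <= (count (inbox x (dil P m)) A)%:R.
  move=> Kx.
  have Kx2 : Kin m K (2 * P) x by apply: Kin_sub Kx; rewrite leq_mul2r orbT.
  have := constK z x P Kz Kx2 PM => h1.
  have /andP[te er] := err_rho P.
  have h2 : 2 * b * P%:R ^+ k * mu%:R <=
      (count (inbox z (dil P m)) A)%:R + tau * mu%:R.
    rewrite -(ler_pM2l K0); apply: le_trans zN; rewrite !mulrA.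
    rewrite le_eqVlt; apply/orP; left; apply/eqP; congr (_ * _ * _).
    by rewrite bE; field; rewrite lt0r_neq0.
  have h3 : tau + rho k J D tau P <= b * P%:R ^+ k.
    have : 2 * sigma * P%:R ^+ k <= b * P%:R ^+ k.
      by rewrite ler_wpM2r// (le_trans _ PK).
    have : sigma <= sigma * P%:R ^+ k by rewrite ler_peMr// ltW.
    have := rho1; lra.
  have := ler_wpM2r (ler0n R mu) h3; rewrite betaE; lra.
have theta0 : 0 <= theta by rewrite thE !mulr_ge0 ?exprn_ge0.
have thetaE : theta <= w * sigma * P%:R ^+ k.
  have -> : w * sigma * P%:R ^+ k = 2 * 2 ^+ k * (sigma * (8 * P)%:R ^+ k).
    by rewrite wE natrM exprMn; ring.
  by rewrite thE ler_wpM2l// mulr_ge0// ltW.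
have theta_beta : 4 * theta < beta.
  have : 4 * w * sigma * P%:R ^+ k < b * P%:R ^+ k.
    by rewrite ltr_pM2r// (lt_le_trans _ PK).
  move: thetaE; rewrite betaE; lra.
have T_gt : 3 * theta < T.
  rewrite -(ltr_pM2r mu0') TE.
  have h1 := smallA y0 y0K16.
  have h2 : (count (inbox y0 (dil P m)) A)%:R <=
      (count (inbox y0 (dil (8 * P) m)) A)%:R :> R.
    rewrite ler_nat; apply: count_imp => a _ /inboxP ya; apply/inboxP => i.
    have := ya i; rewrite /dil -mulnA natrM; have := ler0n R (P * m i).
    by move=> ? /andP[? ?]; apply/andP; split; lra.
  have h3 : 4 * theta * mu%:R < beta * mu%:R by rewrite ltr_pM2r.
  have h4 : 0 <= theta * mu%:R by rewrite mulr_ge0.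
  have : (count (inbox y0 (dil (8 * P) m)) A)%:R <=
    2 ^+ k * (count (inbox y0 (dil (8 * P) m)) A)%:R :> R by rewrite ler_peMl.
  lra.
have D0_gt : (2 * P)%:R ^+ k < D0.+1%:R * beta.
  rewrite natrM exprMn betaE mulrA ltr_pM2r ?(lt_le_trans _ PK)//.
  by rewrite -ltr_pdivrMr// (le_lt_trans D0P)// ltr_nat.
have D0_le i : (D0`! <= P * m i)%N by rewrite (leq_trans (mD i))// leq_pmull.
have boxKP (x y : 'rV[R]_k) : K x -> K y ->
    forall i, `|x 0 i - y 0 i| <= 2 ^+ (J.+1) * (P * m i)%:R.
  move=> Kx Ky i; apply: (le_trans (boxK _ _ Kx Ky i)).
  by rewrite -natrX -natrM ler_nat expnS leq_mul// leq_pmull.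
have allL := @all_congruent R k A G m P T theta beta m0 uA AG K convK AK lowA upG smallA theta0 theta_beta
  y0 y0K D0 D0_gt D0_le P0 J.+1 boxKP T_gt.
have LB := @latticeB R k A G m P T theta beta m0 uA AG K convK lowA upG smallA
  theta0 theta_beta y0 y0K D0 D0_gt D0_le.
have missing := @box_missing R k A G m P T theta beta m0 uA AG K convK lowA upG smallA theta0 theta_beta
  y0 y0K D0 D0_gt D0_le P0.
have Fin : {in F, forall x, x \in zbox 0 n}.
  move=> x /HF[/Kn xn _ _]; apply/mem_zboxP => i; have := xn i.
  by rewrite !mxE add0r ler0z -[(n i)%:R]/((n i)%:Z%:~R) ltr_int.
(* This many boxes of [P] cells span [2 * 2 ^ J] cells, hence the whole side [n]. *)
pose Tn := (16 * 2 ^ r)%N.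
pose y (f : {ffun 'I_k -> 'I_Tn}) : 'rV[R]_k := \row_i (f i * (P * m i))%:R.
pose inF f x := cornerK K m (5 * (8 * P)) (pt x) && inbox (y f) (dil P m) x.
have Fcover : (count predT F <= count (fun x => ~~ cornerK K m (5 * (8 * P)) (pt x)) F +
    \sum_f count (inF f) F)%N.
  apply: (@leq_trans (count (fun x => ~~ cornerK K m (5 * (8 * P)) (pt x)) F +
      count (fun x => cornerK K m (5 * (8 * P)) (pt x)) F)).
    by apply: count_or => x _ _; rewrite orNb.
  rewrite leq_add2l; apply: count_ex => x xF xK.
  have /mem_zboxP xn := Fin x xF.
  have lt_i i : (absz (x 0%R i) %/ (P * m i) < Tn)%N.
    rewrite ltn_divLR ?muln_gt0 ?P0 ?m0//.
    have -> : (Tn * (P * m i) = 2 * 2 ^ J * m i)%N.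
      by rewrite MP /Tn; move: (2 ^ r)%N P (m i) => q P' m'; clear; lia.
    apply: (leq_trans _ (nm i)); have := xn i; rewrite !mxE.
    by move: (x 0 i) (n i) => c d; clear; lia.
  exists [ffun i => Ordinal (lt_i i)]; rewrite /inF xK/=; apply/inboxP => i.
  rewrite mxE ffunE/= /dil -natrD -mulSnr.
  have x0 : (0 <= x 0 i)%R by have := xn i; rewrite mxE => /andP[].
  have -> : (x 0 i)%:~R = (absz (x 0%R i))%:R :> R by rewrite natr_absz ger0_norm.
  rewrite ler_nat ltr_nat leq_trunc_div/= ltn_ceil// muln_gt0 P0 m0//.
have cell_le f : (count (inF f) F)%:R * beta <= (3 * P)%:R ^+ k * (2 * theta) * mu%:R.
  have [/hasP[x xF /andP[xK xf]]|] := boolP (has (inF f) F); last first.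
    rewrite has_count -leqNgt leqn0 => /eqP ->; rewrite mul0r.
    by rewrite !mulr_ge0 ?exprn_ge0.
  (* The depth [40 * P] of one point of the box leaves [32 * P] at its corner. *)
  have Ky : Kin m K (32 * P) (y f).
    apply: (@Kin_shift _ _ _ _ _ (8 * P) (pt x)).
      by rewrite -mulnDl (_ : 32 + 8 = 5 * 8)%N// -mulnA; exact: cornerK_Kin xK.
    move=> i; move/inboxP: xf => /(_ i); have := ler0n R (P * m i).
    rewrite [pt x 0 i]mxE natr_dil /dil ler_norml.
    move: (y f 0 i) (x 0 i)%:~R (P * m i)%:R => c d e.
    by move=> ? /andP[? ?]; apply/andP; split; lra.
  rewrite -size_filter; apply: (missing _ _ Ky); first by rewrite filter_uniq.
  move=> x'; rewrite mem_filter => /andP[/andP[_ x'f] x'F].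
  by have [_ x'A x'L] := HF _ x'F; split=> //; apply: x'L.
have FK : {in F, forall x : 'rV[int]_k, K (pt x)} by move=> x /HF[].
have := count_boundary convK M0 mn Kn (5 * (8 * P)) uF FK; rewrite qM.
set c0 := count _ F => bnd.
have sumle : (\sum_f count (inF f) F)%:R * beta <=
    (6 ^+ k * (2 * theta)) * (\prod_i n i)%:R.
  rewrite natr_sum mulr_suml.
  apply: (@le_trans _ _ (\sum_(f : {ffun 'I_k -> 'I_Tn})
      (3 * P)%:R ^+ k * (2 * theta) * mu%:R)).
    by apply: ler_sum => f _; exact: cell_le.
  rewrite sumr_const card_ffun !card_ord -[leLHS]mulr_natl natrX.
  have -> : Tn%:R ^+ k * ((3 * P)%:R ^+ k * (2 * theta) * mu%:R) =
      6 ^+ k * (2 * theta) * ((2 ^ J)%:R ^+ k * mu%:R) :> R.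
    have e6 : Tn%:R * (3 * P)%:R = 6 * (2 ^ J)%:R :> R.
      by rewrite MP /Tn !natrM; ring.
    transitivity ((Tn%:R * (3 * P)%:R) ^+ k * (2 * theta) * mu%:R).
      by rewrite exprMn; ring.
    by rewrite e6 exprMn; ring.
  by rewrite ler_wpM2l// !mulr_ge0 ?exprn_ge0.
have beta0 : 0 < beta by rewrite betaE mulr_gt0// (lt_le_trans _ PK).
have sumle2 : (\sum_f count (inF f) F)%:R <= eta * eps / 2 * (\prod_i n i)%:R.
  rewrite -(ler_pM2r beta0); apply: (le_trans sumle).
  rewrite [leRHS]mulrAC ler_wpM2r//.
  have Pk0 : 0 <= P%:R ^+ k :> R by rewrite exprn_ge0.
  apply: (@le_trans _ _ (6 ^+ k * (2 * (w * sigma * P%:R ^+ k)))).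
    by rewrite ler_wpM2l ?exprn_ge0// ler_wpM2l.
  rewrite betaE mulrA; have := ler_wpM2r Pk0 sgP2; rewrite !mulrA; apply: le_trans.
  by rewrite le_eqVlt; apply/orP; left; apply/eqP; ring.
have bnd2 : c0%:R <= eta * eps / 2 * (\prod_i n i)%:R.
  by apply: (le_trans bnd); rewrite mulrA ler_wpM2r.
have : (size F)%:R <= c0%:R + (\sum_f count (inF f) F)%:R :> R.
  by rewrite -natrD ler_nat -count_predT.
have := ler_wpM2l (ltW eta0) epsA; rewrite mulrA.
move: (_ * _%:R) (size F)%:R => u v.
lra.
Qed.
End BoxCore.

Section BoxStability.
Variables (R : archiRealFieldType) (k : nat).
Hypothesis k0 : (0 < k)%N.
Local Notation pt := (map_mx intr : 'rV[int]_k -> 'rV[R]_k).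

Lemma small_parameter (eps eta : R) : 0 < eps -> 0 < eta ->
  let b := eps / (2 * 2 ^+ k) in let w := 2 * 2 ^+ k * 8 ^+ k in
  exists2 sigma : R, 0 < sigma <= 1 &
   4 * w * sigma < b /\ 6 ^+ k * 2 * w * sigma <= eta * eps / 2 * b.
Proof.
move=> eps0 eta0 b w.
have b0 : 0 < b by rewrite divr_gt0// mulr_gt0.
have w0 : 0 < w by rewrite !mulr_gt0 ?exprn_gt0.
(* The 5 in place of 4 makes the first inequality strict. *)
pose s2 := b / (5 * w); pose s3 := eta * eps / 2 * b / (6 ^+ k * 2 * w).
have s20 : 0 < s2 by rewrite divr_gt0// mulr_gt0.
have h1 : 0 < eta * eps / 2 * b by apply: mulr_gt0 => //; rewrite divr_gt0 ?mulr_gt0.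
have h2 : 0 < 6 ^+ k * 2 * w by rewrite !mulr_gt0 ?exprn_gt0.
have s30 : 0 < s3 by exact: divr_gt0.
exists (Num.min 1 (Num.min s2 s3)); first by rewrite !lt_min ltr01 s20 s30 ge_min lexx.
set s := Num.min _ _.
have ss2 : s <= s2 by rewrite /s !ge_min lexx !orbT.
have ss3 : s <= s3 by rewrite /s !ge_min lexx !orbT.
split.
  apply: (@le_lt_trans _ _ (4 * w * s2)); first by rewrite ler_pM2l// mulr_gt0.
  have -> : 4 * w * s2 = 4 / 5 * b by rewrite /s2; field; rewrite lt0r_neq0.
  lra.
have -> : eta * eps / 2 * b = 6 ^+ k * 2 * w * s3.
  by rewrite /s3 [RHS]mulrC divfK// lt0r_neq0.
by rewrite ler_pM2l.
Qed.

Lemma scale_parameter (eps eta : R) : 0 < eps -> 0 < eta ->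
  exists r : nat, 2 ^+ k * (k%:R * (21 / 2 ^+ r)) < eps /\
    2 ^+ k * (k%:R * (5 / 2 ^+ r)) <= eta * eps / 2.
Proof.
move=> eps0 eta0; have K0 : 0 <= 2 ^+ k * k%:R :> R by rewrite mulr_ge0 ?exprn_ge0.
have [r r0 rP] := nat_above (2 ^+ k * k%:R * 21 / eps +
  2 ^+ k * k%:R * 5 / (eta * eps / 2)).
have r2 : r%:R < 2 ^+ r :> R by rewrite -natrX ltr_nat ltn_expl.
have e0 : 0 < eta * eps / 2 by rewrite divr_gt0// mulr_gt0.
have u1 : 0 <= 2 ^+ k * k%:R * 21 / eps.
  by apply: divr_ge0; [rewrite mulr_ge0|exact: ltW].
have u2 : 0 <= 2 ^+ k * k%:R * 5 / (eta * eps / 2).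
  by apply: divr_ge0; [rewrite mulr_ge0|exact: ltW].
exists r; rewrite !mulrA ltr_pdivrMr// ler_pdivrMr//; split.
  have : 2 ^+ k * k%:R * 21 / eps < 2 ^+ r by lra.
  by rewrite ltr_pdivrMr// [ltRHS]mulrC.
have : 2 ^+ k * k%:R * 5 / (eta * eps / 2) <= 2 ^+ r by lra.
by rewrite ler_pdivrMr// [leRHS]mulrC.
Qed.

(** The order of choice matters: [r] and [sigma] depend on [eps] and [eta] only, then [s] fixes [J],
    [D], [P] and [tau], and [d0] and the least side come last. *)
Lemma box_stability (eps eta : R) : 0 < eps -> 0 < eta ->
  exists2 d0 : R, 0 < d0 & exists n0 : nat,
  forall (n : 'I_k -> nat) (A G : seq 'rV[int]_k),
  (forall i, n0 <= n i)%N -> uniq A -> uniq G ->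
  {in A &, forall a b : 'rV[int]_k, a + b \in G} ->
  {subset A <= zbox 0 n} -> A != [::] ->
  eps * (\prod_i n i)%:R <= (size A)%:R ->
  (size G)%:R <= 2 ^+ k * (size A)%:R + d0 * (size A)%:R ->
  forall K : pred 'rV[R]_k,
  (forall x y (t : R), 0 <= t <= 1 -> K x -> K y -> K (t *: x + (1 - t) *: y)) ->
  {in A, forall a : 'rV[int]_k, K (pt a)} ->
  (forall x, K x -> forall c : 'rV[R]_k,
     exists2 b : 'rV[int]_k, b \in A & \sum_i c 0 i * ((b 0 i)%:~R - x 0 i) <= 0) ->
  (forall x, K x -> forall i, 0 <= x 0 i < (n i)%:R) ->
  forall F : seq 'rV[int]_k, uniq F ->
  {in F, forall x : 'rV[int]_k, [/\ K (pt x), x \notin A & congruent_to A x]} ->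
  (size F)%:R <= eta * (size A)%:R.
Proof.
move=> eps0 eta0.
have [r [rP1 rP2]] := scale_parameter eps0 eta0.
have /= [sigma /andP[sg0 sg1] [sgP1 sgP2]] := small_parameter eps0 eta0.
set b := eps / _ in sgP1 sgP2; set w := _ * 8 ^+ k in sgP1 sgP2.
have K1 : 1 <= 2 ^+ k :> R by rewrite exprn_ege1// ler1n.
have w1 : 1 <= w.
  by rewrite mulr_ege1 ?exprn_ege1 ?ler1n// mulr_ege1// ler1n.
have sgb : 2 * sigma <= b by nra.
have [s sr sP] := exp_dominates (1024 * k%:R ^+ 2 * 4 ^+ k * 2 ^+ r / sigma) (r + 3).
(* With [J] a multiple of 3, 2^(2J/3) is the integer 4^s. The constant given to [exp_dominates] is
   what makes [scaleD] hold after division by 4^s. *)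
pose J := (3 * s)%N; pose M := (2 ^ J)%N; pose D := (8 * k * 4 ^ s)%N.
pose P := (2 ^ (J - 3 - r))%N.
have MP : M = (8 * 2 ^ r * P)%N.
  have JE : (3 + r + (J - 3 - r) = J)%N by move: sr; rewrite /J; clear; lia.
  by rewrite /M -JE !expnD.
have M0 : (0 < M)%N by rewrite expn_gt0.
have D1 : (0 < D)%N by rewrite !muln_gt0 k0 expn_gt0.
pose tau := sigma / (4 * J.+1%:R).
have tau0 : 0 < tau by rewrite divr_gt0// mulr_gt0.
have tauJ : 4 * J.+1%:R * tau = sigma.
  by rewrite mulrC divfK// lt0r_neq0// mulr_gt0.
have scaleD : 16 * k%:R * 4 ^+ k * J.+1%:R * D%:R <= sigma * P%:R :> R.
  have r0 : 0 < 8 * 2 ^+ r :> R by rewrite mulr_gt0 ?exprn_gt0.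
  have ME : sigma * 2 ^+ s * 4 ^+ s = 8 * 2 ^+ r * (sigma * P%:R) :> R.
    have ME' : 2 ^+ s * 4 ^+ s = M%:R :> R.
      by rewrite /M /J natrX exprM -exprMn; congr (_ ^+ s); ring.
    by rewrite -mulrA ME' MP !natrM natrX; ring.
  rewrite -(ler_pM2l r0) -ME natrM natrM natrX.
  move: sP; rewrite mulrAC ler_pdivrMr// natrX addn1 -/J => sP'.
  have s4 : 0 <= 4 ^+ s :> R by rewrite exprn_ge0.
  have := ler_wpM2r s4 sP'; rewrite (mulrC (2 ^+ s)).
  by apply: le_trans; rewrite le_eqVlt; apply/orP; left; apply/eqP; ring.
have DP : (2 * D <= P)%N.
  rewrite -(ler_nat R) natrM.
  have : sigma * P%:R <= P%:R by rewrite ler_piMl.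
  have k1 : 1 <= k%:R :> R by rewrite ler1n.
  have k4 : 1 <= 4 ^+ k :> R by rewrite exprn_ege1// ler1n.
  have J1 : 1 <= J.+1%:R :> R by rewrite ler1n.
  have c1 : 1 <= k%:R * 4 ^+ k * J.+1%:R :> R by do 2!apply: mulr_ege1 => //.
  have := ler_wpM2r (ler0n R D) c1; have := ler0n R D; move: scaleD.
  rewrite -!mulrA; move: (k%:R * _) => c; lra.
have [d0 d00 [n1 KP]] := doubling_homothety k tau0 M0.
have [D0 D00 D0P] := nat_above (2 ^+ k / b).
exists d0 => //; exists (maxn n1 (M * D0`!)) => n A G hn uA uG AG An A0 epsA hG.
move=> K convK AK hullK Kn F uF HF.
have hn1 i : (n1 <= n i)%N by have := hn i; rewrite geq_max => /andP[].
have {KP} HG := KP n A G hn1 uA uG AG An hG.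
pose m i := (n i %/ M)%N; rewrite -/m in HG.
have mD i : (D0`! <= m i)%N.
  by rewrite /m leq_divRL// mulnC; have := hn i; rewrite geq_max => /andP[].
have m0 i : (0 < m i)%N by apply: leq_trans (mD i); exact: fact_gt0.
have mn i : (M * m i <= n i)%N by rewrite mulnC leq_trunc_div.
have nm i : (n i <= 2 * 2 ^ J * m i)%N.
  rewrite (leq_trans (ltnW (ltn_ceil (n i) M0)))// -/(m i) -/M mulnAC leq_mul//.
  by rewrite mul2n -addnn -addn1 leq_add2l m0.
have {HG} HG (x : 'rV[R]_k) Q : (Q <= 2 * 2 ^ J)%N ->
    (count (inbox (x + x) (dil (2 * Q) m)) G)%:R <=
    2 ^+ k * (count (inbox x (dil Q m)) A)%:R + tau * (\prod_i m i)%:R.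
  exact: HG.
have hrho Q : (P <= Q)%N -> rho k J D tau Q <= sigma * Q%:R ^+ k.
  by move=> PQ; apply: (@rho_small _ k J D P) => //; rewrite ?tauJ// ltW.
have tauJ4 : 4 * tau <= sigma.
  have : tau <= J.+1%:R * tau by rewrite ler_peMl ?ler1n// ltW.
  by rewrite -tauJ; lra.
have beps : b <= eps.
  rewrite /b ler_pdivrMr ?mulr_gt0// ler_peMr ?(ltW eps0)//; lra.
have P8 : (P <= 8 * P)%N by rewrite leq_pmull.
have Dsq : (24 * k <= D ^ 2)%N.
  have h1 : (1 <= 16 ^ s)%N by rewrite expn_gt0.
  have -> : (D ^ 2 = 64 * k ^ 2 * 16 ^ s)%N.
    by rewrite /D !expnMn -(expnM 4) [(s * 2)%N]mulnC (expnM 4).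
  rewrite -[(24 * k)%N]muln1; apply: leq_mul => //; apply: leq_mul => //.
  by rewrite -{1}[k]expn1 leq_pexp2l.
have D6 : (1536 * k ^ 3 * (2 ^ J) ^ 4 <= D ^ 6)%N.
  have -> : (D ^ 6 = 8 ^ 6 * k ^ 6 * (2 ^ J) ^ 4)%N.
    have -> : ((2 ^ J) ^ 4 = (4 ^ s) ^ 6)%N.
      by rewrite -[4%N in RHS](expnS 2 1) -!expnM; congr (2 ^ _)%N; rewrite /J; clear; lia.
    by rewrite /D !expnMn.
  have c6 : (1536 <= 8 ^ 6)%N.
    by apply: (@leq_trans (2 ^ 11)); rewrite // -[8%N]/(2 ^ 3)%N -expnM leq_exp2l.
  apply: leq_mul; last exact: leqnn.
  by apply: leq_mul; [exact: c6|rewrite leq_pexp2l].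
have jJ : (J - 3 - r <= J.+1)%N by rewrite -subnDA (leq_trans (leq_subr _ _)).
have tsg : tau <= sigma by lra.
have teps : 2 * tau < eps by lra.
exact: (@box_core R k k0 eps eta sigma tau r J (J - 3 - r) D P D0 b w erefl erefl
  eps0 eta0 sg0 tau0 rP1 rP2 sgP1 sgP2 tsg teps MP erefl jJ (hrho _ P8)
  (hrho _ (leqnn P)) Dsq D6 D0P n m A G uA AG An A0 epsA mD mn nm HG K convK AK
  hullK Kn F uF HF).
Qed.

End BoxStability.

Import numFieldNormedType.Exports.

Local Open Scope classical_set_scope.
Local Open Scope ring_scope.

(** * From boxes to progressions *)

Section Transfer.
Variables (R : realType) (k : nat).
Local Notation pt := (map_mx intr : 'rV[int]_k -> 'rV[R]_k).

Lemma convex_setP (C : set 'rV[R]_k) : @convex_set R 'rV[R]_k C <->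
  forall x y (t : R), 0 <= t <= 1 -> C x -> C y -> C (t *: x + (1 - t) *: y).
Proof.
split=> [cC x y t /andP[t0 t1] Cx Cy|cC x y t].
  by have := cC x y (Itv01 t0 t1); rewrite !inE; apply.
by rewrite !inE; apply: cC; apply/andP; split.
Qed.

(** Zero, opposites, sums and integer multiples all arise from subtraction. *)
Lemma span_closed (A : {fset 'rV[int]_k}) (a x : 'rV[int]_k)
    (L : 'rV[int]_k -> Prop) :
  (forall s t, L s -> L t -> L (s - t)) -> a \in A ->
  {in A, forall y, L (y - a)} ->
  inIntSpan (in_tuple [seq y - a | y <- enum_fset A]) (x - a) -> L (x - a).
Proof.
move=> LB aA LA [c ->].
have L0 : L 0 by rewrite -(subrr (a - a)); apply: LB; apply: LA.
have LN s : L s -> L (- s) by move=> Ls; rewrite -sub0r; apply: LB.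
have LD s t : L s -> L t -> L (s + t).
  by move=> Ls Lt; rewrite -[t]opprK; apply: LB => //; apply: LN.
have Ln s n : L s -> L (s *+ n).
  move=> Ls; elim: n => [|n IH]; first by rewrite mulr0n.
  by rewrite mulrS; apply: LD.
apply: (big_ind L) => // i _; set s := nth _ _ _.
have Ls : L s.
  rewrite /s/=; have /mapP[y yA ->] : [seq y - a | y <- enum_fset A]`_i
      \in [seq y - a | y <- enum_fset A] by exact: mem_nth.
  exact: LA.
by case: (c i) => n; [exact: Ln|apply: LN; exact: Ln].
Qed.

Variables (n : 'I_k -> nat) (v : 'I_k -> 'rV[int]_k) (b : 'rV[int]_k).
Hypothesis free_v : lin_indep R v.

Definition lin (l : 'rV[int]_k) : 'rV[int]_k := \sum_i l 0 i *: v i.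
Definition linR (x : 'rV[R]_k) : 'rV[R]_k := \sum_i x 0 i *: pt (v i).

Lemma linB l l' : lin (l - l') = lin l - lin l'.
Proof.
by rewrite /lin -sumrB; apply: eq_bigr => i _; rewrite !mxE scalerBl.
Qed.

Lemma linD l l' : lin (l + l') = lin l + lin l'.
Proof.
by rewrite /lin -big_split; apply: eq_bigr => i _; rewrite !mxE scalerDl.
Qed.

Lemma pt_lin l : pt (lin l) = linR (pt l).
Proof.
apply/rowP => j; rewrite !mxE !summxE rmorph_sum/=; apply: eq_bigr => i _.
by rewrite !mxE intrM.
Qed.

Lemma linR_inj x y : linR x = linR y -> x = y.
Proof.
have : free [tuple embed R (v i) | i < k] by exact: free_v.
move=> /freeP fr xy; apply/rowP => i; apply/eqP; rewrite -subr_eq0; apply/eqP.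
apply: (fr (fun i => x 0 i - y 0 i)).
move/eqP: xy; rewrite -subr_eq0 /linR -sumrB => /eqP xy.
rewrite -[RHS]xy; apply: eq_bigr => j _.
by rewrite -scalerBl -tnth_nth tnth_mktuple.
Qed.

Lemma lin_inj : injective lin.
Proof.
move=> l l' ll; have /linR_inj/rowP pp : linR (pt l) = linR (pt l').
  by rewrite -!pt_lin ll.
by apply/rowP => i; have := pp i; rewrite !mxE => /intr_inj.
Qed.

Lemma gapP x : reflect (exists2 l, l \in zbox 0 n & x = b + lin l) (x \in gap n v b).
Proof.
apply: (iffP idP) => [/imfsetP[f /= _ ->]|[l /mem_zboxP ln ->]].
  exists (\row_i (f i : nat)%:Z); first by apply/mem_zboxP => i; rewrite !mxE add0r /= ltz_nat ltn_ord.
  by congr (_ + _); apply: eq_bigr => i _; rewrite mxE -scaler_nat natz.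
have lt_i i : (absz (l 0%R i) < n i)%N.
  by have := ln i; rewrite mxE; move: (l 0 i) (n i) => c d; clear; lia.
apply/imfsetP; exists (finfun (fun i => Ordinal (lt_i i))) => //.
congr (_ + _); apply: eq_bigr => i _; rewrite ffunE/=.
have l0 : (0 <= l 0 i)%R by have := ln i; rewrite mxE => /andP[].
by rewrite -scaler_nat natz gez0_abs.
Qed.

Lemma size_gap : (\prod_i n i <= #|` gap n v b|)%N.
Proof.
rewrite -(size_zbox 0) -(size_map (fun l => b + lin l)); apply: uniq_leq_size.
  by rewrite map_inj_uniq ?zbox_uniq// => l l' /addrI/lin_inj.
by move=> _ /mapP[l ln ->]; apply/gapP; exists l.
Qed.

Variable A : {fset 'rV[int]_k}.
Hypothesis Agap : (A `<=` gap n v b)%fset.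

Definition coords : seq 'rV[int]_k := [seq l <- zbox 0 n | b + lin l \in A].
Local Notation missing := (fset_set (discrete_hull R A `\` [set` A])).
Definition hull : set 'rV[R]_k := convex_hull [set pt l | l in [set` coords]].

Lemma mem_coords l : (l \in coords) = (b + lin l \in A).
Proof.
rewrite mem_filter andb_idr// => /(fsubsetP Agap)/gapP[l' l'n].
by move=> /addrI/lin_inj ->.
Qed.

Lemma coordsP a : a \in A -> exists2 l, l \in coords & a = b + lin l.
Proof.
move=> aA; have /gapP[l ln al] := fsubsetP Agap _ aA.
by exists l; rewrite // mem_coords -al.
Qed.

Lemma coords_uniq : uniq coords.
Proof. by rewrite filter_uniq// zbox_uniq. Qed.

Lemma size_coords : size coords = #|` A|.
Proof.
rewrite -(size_map (fun l => b + lin l)); apply/perm_size/uniq_perm.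
- by rewrite map_inj_uniq ?coords_uniq// => l l' /addrI/lin_inj.
- exact: fset_uniq.
move=> a; apply/mapP/idP => [[l + ->]|/coordsP[l lc ->]]; last by exists l.
by rewrite mem_coords.
Qed.

Lemma hull_convex x y (t : R) : 0 <= t <= 1 -> hull x -> hull y ->
  hull (t *: x + (1 - t) *: y).
Proof.
move=> t01 hx hy C [cC SC]; move/convex_setP : (cC); apply=> //.
  exact: hx.
exact: hy.
Qed.

Lemma hull_pt l : l \in coords -> hull (pt l).
Proof. by move=> lc C [_ SC]; apply: SC; exists l. Qed.

(** Otherwise an open half-space with [x] on its boundary would contain all the generators, hence
    the hull and [x] itself. *)
Lemma hull_halfspace x : hull x -> forall c : 'rV[R]_k,
  exists2 l : 'rV[int]_k, l \in coords &
    \sum_i c 0 i * ((l 0 i)%:~R - x 0 i) <= 0.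
Proof.
move=> hx c; apply: contrapT => noL.
have : [set y : 'rV[R]_k | 0 < \sum_i c 0 i * (y 0 i - x 0 i)] x.
  apply: hx; split.
    apply/convex_setP => y z t /andP[t0 t1] /= y0 z0.
    have -> : \sum_i c 0 i * ((t *: y + (1 - t) *: z) 0 i - x 0 i) =
        t * (\sum_i c 0 i * (y 0 i - x 0 i)) +
        (1 - t) * \sum_i c 0 i * (z 0 i - x 0 i).
      by rewrite !mulr_sumr -big_split; apply: eq_bigr => i _; rewrite !mxE/=; ring.
    have [t00|tn0] := eqVneq t 0; first by rewrite t00 mul0r add0r subr0 mul1r.
    apply: ltr_pwDl; first by rewrite mulr_gt0// lt0r tn0.
    by rewrite mulr_ge0 ?subr_ge0// ltW.
  move=> _ [l lc <-] /=; rewrite ltNge; apply/negP => le0; apply: noL.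
  exists l => //; apply: le_trans le0.
  by under [leRHS]eq_bigr do rewrite mxE.
by rewrite /= big1 ?ltxx// => i _; rewrite subrr mulr0.
Qed.

Lemma hull_box x : hull x -> forall i, 0 <= x 0 i < (n i)%:R.
Proof.
move=> hx; apply: (hx [set y : 'rV[R]_k | forall i, 0 <= y 0 i < (n i)%:R]); split.
  apply/convex_setP => y z t /andP[t0 t1] /= yn zn i.
  have /andP[y0 y1] := yn i; have /andP[z0 z1] := zn i; rewrite !mxE.
  have t1' : 0 <= 1 - t by rewrite subr_ge0.
  rewrite addr_ge0 ?mulr_ge0//=.
  have [t00|tn0] := eqVneq t 0; first by rewrite t00 mul0r add0r subr0 mul1r.
  have -> : (n i)%:R = t * (n i)%:R + (1 - t) * (n i)%:R :> R by ring.
  by rewrite ltr_leD ?ltr_pM2l ?lt0r ?tn0//; rewrite ler_wpM2l// ltW.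
move=> _ [l lc <-] i /=; rewrite mxE.
move: lc; rewrite /= mem_filter => /andP[_ /mem_zboxP/(_ i)].
by rewrite mxE add0r ler0z -[(n i)%:R]/((n i)%:Z%:~R) ltr_int.
Qed.

(** Integral coordinates come from the lattice condition, since differences of points of [A] are
    values of [lin]. For the hull, the affine image of a convex set containing the coordinates is
    convex and contains [A], hence [x]; injectivity brings the point back. *)
Lemma discrete_hull_coords x : discrete_hull R A x ->
  exists l, [/\ x = b + lin l, hull (pt l) & congruent_to coords l].
Proof.
move=> [hx [a aA span]]; have [l0 l0c al0] := coordsP aA.
have [l1 xl1] : exists l1, x - a = lin l1.
  apply: (span_closed (L := fun y => exists l1, y = lin l1)) span => //.
    by move=> _ _ [l ->] [l' ->]; exists (l - l'); rewrite linB.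
  move=> y /coordsP[l lc ->]; exists (l - l0).
  by rewrite al0 linB opprD addrACA subrr add0r.
pose l := l0 + l1.
have xl : x = b + lin l by rewrite linD addrA -al0 -xl1 subrKC.
exists l; split=> //.
  move=> C [/convex_setP cC SC].
  have [y Cy yx] : [set pt b + linR y | y in C] (embed R x).
    apply: hx; split.
      apply/convex_setP => _ _ t t01 [y Cy <-] [z Cz <-].
      exists (t *: y + (1 - t) *: z); first exact: cC.
      apply/rowP => i; rewrite !mxE /linR !summxE !mulrDr !mulr_sumr.
      rewrite addrACA -mulrDl subrKC mul1r -big_split; congr (_ + _).
      by apply: eq_bigr => j _; rewrite !mxE /=; ring.
    move=> _ [y /coordsP[l' l'c ->] <-]; exists (pt l'); first by apply: SC; exists l'.
    by rewrite -pt_lin -map_mxD.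
  suff <- : y = pt l by [].
  apply: linR_inj; apply: (addrI (pt b)).
  by rewrite yx xl -pt_lin -map_mxD.
move=> L LB Lc l2 l2c.
have [l3 Ll3 xl3] : exists2 l3, L l3 & x - a = lin l3.
  apply: (span_closed (L := fun y => exists2 l3, L l3 & y = lin l3)) span => //.
    move=> _ _ [l' Ll' ->] [l'' Ll'' ->]; exists (l' - l''); last by rewrite linB.
    exact: LB.
  move=> y /coordsP[l' lc ->]; exists (l' - l0); first exact: Lc.
  by rewrite al0 linB opprD addrACA subrr add0r.
have -> : l - l2 = l3 - (l2 - l0).
  have -> : l3 = l1 by apply: lin_inj; rewrite -xl3.
  by rewrite /l opprB addrA (addrC l1).
by apply: LB => //; exact: Lc.
Qed.

Definition missing_coords : seq 'rV[int]_k := [seq l <- zbox 0 n | b + lin l \in missing].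

Lemma in_missing x : (x \in missing) = (x \in discrete_hull R A `\` [set` A]).
Proof.
by rewrite in_fset_set//; apply: finite_setD; exact: finite_discrete_hull.
Qed.

Lemma missing_coordsP l : l \in missing_coords ->
  [/\ `[< hull (pt l) >], l \notin coords & congruent_to coords l].
Proof.
rewrite mem_filter in_missing => /andP[+ _].
rewrite inE => -[/discrete_hull_coords[l' [/addrI/lin_inj <- hl cl]] nA].
by split=> //; [exact/asboolP|rewrite mem_coords; apply/negP].
Qed.

Lemma size_missing : (#|` missing| <= size missing_coords)%N.
Proof.
rewrite -(size_map (fun l => b + lin l)); apply: uniq_leq_size.
  exact: fset_uniq.
move=> x xm; have := xm; rewrite in_missing inE => -[].
move=> /discrete_hull_coords[l [xl hl _]] _.
apply/mapP; exists l => //; rewrite mem_filter -xl xm/=.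
apply/mem_zboxP => i; have := hull_box hl i.
by rewrite !mxE add0r ler0z -[(n i)%:R]/((n i)%:Z%:~R) ltr_int.
Qed.

Definition double_coords : seq 'rV[int]_k :=
  [seq l <- zbox 0 (fun i => 2 * n i)%N | b + b + lin l \in sumset A A].

Lemma double_coords_sum : {in coords &, forall l l', l + l' \in double_coords}.
Proof.
move=> l l' lc l'c; rewrite mem_filter; apply/andP; split.
  rewrite linD addrACA; apply/imfset2P; exists (b + lin l); rewrite -?mem_coords//.
  by exists (b + lin l'); rewrite -?mem_coords.
move: lc l'c; rewrite !mem_filter => /andP[_ /mem_zboxP ln] /andP[_ /mem_zboxP l'n].
apply/mem_zboxP => i; have := ln i; have := l'n i; rewrite !mxE.
by move: (l 0 i) (l' 0 i) (n i) => c d e; clear; lia.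
Qed.

Lemma size_double_coords : (size double_coords <= #|` sumset A A|)%N.
Proof.
rewrite -(size_map (fun l => b + b + lin l)); apply: uniq_leq_size.
  by rewrite map_inj_uniq ?filter_uniq ?zbox_uniq// => l l' /addrI/lin_inj.
by move=> _ /mapP[l + ->]; rewrite mem_filter => /andP[].
Qed.

(** The hull stays in the coordinate box, so every missing point lies in the progression. This gives
    an admissible bound for every [delta], however large. *)
Lemma trivial_bound (eps : R) : 0 < eps ->
  eps * (#|` gap n v b|)%:R <= (#|` A|)%:R ->
  (#|` missing|)%:R <= eps^-1 * (#|` A|)%:R.
Proof.
move=> eps0 epsA; rewrite mulrC ler_pdivlMr// mulrC; apply: le_trans epsA.
rewrite ler_pM2l// ler_nat (leq_trans size_missing)// (leq_trans _ size_gap)//.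
by rewrite -(size_zbox 0) size_filter count_size.
Qed.

End Transfer.

(** * Choice of the two functions *)

Definition gap_stable (R : realType) (k : nat) (eps delta eta : R) (n0 : nat) : Prop :=
  forall (A : {fset 'rV[int]_k}) (n : 'I_k -> nat) (v : 'I_k -> 'rV[int]_k)
    (b : 'rV[int]_k),
  A != fset0 -> lin_indep R v -> (forall i : 'I_k, (n0 <= n i)%N) ->
  (A `<=` gap n v b)%fset ->
  eps * (#|` gap n v b|)%:R <= (#|` A|)%:R ->
  (doubling_excess A)%:~R <= delta * (#|` A|)%:R ->
  (#|` fset_set (discrete_hull R A `\` [set` A])|)%:R <= eta * (#|` A|)%:R.

Lemma gap_stableW (R : realType) (k : nat) (eps delta delta' eta eta' : R) n0 :
  delta <= delta' -> eta' <= eta ->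
  gap_stable k eps delta' eta' n0 -> gap_stable k eps delta eta n0.
Proof.
move=> dd ee st A n v b A0 fv nn Ag eA dA.
apply: (@le_trans _ _ (eta' * (#|` A|)%:R)); last by rewrite ler_wpM2r.
by apply: (st A n v b) => //; apply: le_trans dA _; rewrite ler_wpM2r.
Qed.

Lemma gap_stable_exists (R : realType) (k : nat) (eps eta : R) : (0 < k)%N ->
  0 < eps -> 0 < eta ->
  exists2 delta : R, 0 < delta & exists n0, gap_stable k eps delta eta n0.
Proof.
move=> k0 eps0 eta0.
have [d d0 [n0 st]] := box_stability k0 eps0 eta0.
exists d => //; exists n0 => A n v b A0 fv nn Ag eA dA.
rewrite -(size_coords fv Ag); apply: le_trans (_ : (size (missing_coords R n v b A))%:R <= _).
  by rewrite ler_nat size_missing.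
apply: (st n (coords n v b A) (double_coords n v b A) nn _ _ _ _ _ _ _
  (fun x => `[< hull n v b A x >])).
- exact: coords_uniq.
- exact/filter_uniq/zbox_uniq.
- exact: (double_coords_sum fv Ag).
- by move=> l; rewrite mem_filter => /andP[].
- by rewrite -size_eq0 (size_coords fv Ag) cardfs_eq0.
- rewrite (size_coords fv Ag); apply: le_trans eA.
  by rewrite ler_pM2l// ler_nat (size_gap _ _ fv).
- rewrite (size_coords fv Ag) (le_trans (_ : _ <= (#|` sumset A A|)%:R))//.
    by rewrite ler_nat (size_double_coords _ _ fv).
  move: dA; rewrite /doubling_excess intrB -lerBlDl; apply: le_trans.
  by rewrite -!pmulrn natrM natrX.
- by move=> x y t t01 /asboolP hx /asboolP hy; apply/asboolP; exact: hull_convex t01 hx hy.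
- by move=> l lc; apply/asboolP; exact: hull_pt lc.
- by move=> x /asboolP; exact: hull_halfspace.
- by move=> x /asboolP; exact: hull_box.
- exact/filter_uniq/zbox_uniq.
exact: (missing_coordsP fv Ag).
Qed.

Theorem theorem1p6 (R : realType) (k : nat) (k_ge1 : (1 <= k)%N) :
  exists (nk : R -> R -> nat) (omega : R -> R -> R),
    (forall eps0 : R, 0 < eps0 -> omega eps0 delta @[delta --> 0^'+] --> 0) /\
    (forall eps0 delta : R, 0 < eps0 -> 0 < delta ->
      forall (A : {fset 'rV[int]_k}) (n : 'I_k -> nat)
             (v : 'I_k -> 'rV[int]_k) (b : 'rV[int]_k),
        A != fset0 ->
        lin_indep R v ->
        (forall i : 'I_k, (nk eps0 delta <= n i)%N) ->
        (A `<=` gap n v b)%fset ->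
        eps0 * (#|` gap n v b|)%:R <= (#|` A|)%:R ->
        (doubling_excess A)%:~R <= delta * (#|` A|)%:R ->
        (#|` fset_set (discrete_hull R A `\` [set` A])|)%:R
          <= omega eps0 delta * (#|` A|)%:R).
Proof.
pose S eps delta := [set eta : R | 0 < eta /\ exists n0, gap_stable k eps delta eta n0].
(* The infimum may not be attained; adding [delta] puts [omega] above an admissible value without
   changing the limit. *)
pose omega eps delta := inf (S eps delta) + delta.
pose nk eps delta := xget 0%N [set n0 | gap_stable k eps delta (omega eps delta) n0].
have S0 eps delta : lbound (S eps delta) 0 by move=> eta [/ltW].
exists nk, omega; split=> [eps eps0|eps delta eps0 delta0].
  apply/cvgrPdist_le => e e0.
  have e2 : 0 < e / 2 by rewrite divr_gt0.
  have [d d0 [n0 st]] := gap_stable_exists k_ge1 eps0 e2.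
  near=> delta.
  have dd : delta <= d by near: delta; exact: nbhs_right_le.
  have de : delta <= e / 2 by near: delta; exact: nbhs_right_le.
  have delta0 : 0 < delta by near: delta; exact: nbhs_right_gt.
  have Se : S eps delta (e / 2).
    by split=> //; exists n0; apply: gap_stableW st.
  have inf_le : inf (S eps delta) <= e / 2 by apply: ge_inf => //; exists 0.
  have inf_ge : 0 <= inf (S eps delta) by apply: lb_le_inf => //; exists (e / 2).
  by rewrite sub0r normrN ger0_norm /omega; lra.
(* The trivial bound makes the set nonempty, so the infimum is a genuine one. *)
have hS : has_inf (S eps delta).
  split; last by exists 0.
  exists eps^-1; split; first by rewrite invr_gt0.
  exists 0%N => A n v b A0 fv nn Ag eA _; exact: (trivial_bound fv Ag eps0 eA).
have [eta [eta0 [n0 st]] eta_lt] := inf_adherent delta0 hS.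
suff : gap_stable k eps delta (omega eps delta) (nk eps delta) by [].
apply: (xgetPex 0%N (P := [set n0 | gap_stable k eps delta (omega eps delta) n0])).
by exists n0; apply: gap_stableW st; rewrite // ltW.
Unshelve. all: by end_near.
Qed.
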